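(* Let $G$ be a $\emptyset$-definable group in a monster model $\mathfrak C$, let $X\subseteq G$ be a $\emptyset$-definable approximate subgroup, and let $H:=\langle X\rangle$ be the subgroup generated by $X$. The following conditions are equivalent: \begin{enumerate} \item $H^{000}_\emptyset=H^{00}_\emptyset$. \item There is $m\geq1$ such that $H^{00}_\emptyset\subseteq Y^m$ for every $\emptyset$-definable, generic, symmetric subset $Y$ of $H$. \item There is $m\geq1$ such that $H^{000}_\emptyset\subseteq Y^m$ for every $\emptyset$-definable, generic, symmetric subset $Y$ of $H$. \end{enumerate}
   Context: A monster model is $\kappa$-saturated and strongly $\kappa$-homogeneous for a sufficiently large cardinal $\kappa$; bounded means of cardinality $<\kappa$. A set $Y$ is symmetric if $Y=Y^{-1}$ and $1\in Y$. An approximate subgroup is a symmetric subset $X$ such that $X^2=XX$ is contained in finitely many left translates of $X$. $Y^m$ is the $m$-fold product set. A definable subset $D$ of $H$ is generic if finitely many left translates of $D$ by elements of $H$ cover $X$. $H^{000}_\emptyset$ is the smallest $\mathrm{Aut}(\mathfrak C)$-invariant subgroup of $H$ of bounded index (it always exists). $H^{00}_\emptyset$ is the smallest $\emptyset$-type-definable subgroup of $H$ of bounded index; it exists if and only if $H$ contains some $\emptyset$-type-definable subgroup of bounded index, which need not be the case. Conditions (1) and (2) are understood to include the existence of $H^{00}_\emptyset$. *)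

(* Defs.v *)
From mathcomp Require Import all_boot.
From mathcomp Require Import mathcomp_extra boolp classical_sets functions.
From mathcomp Require Import cardinality.

Set Implicit Arguments.
Unset Strict Implicit.
Unset Printing Implicit Defensive.

Local Open Scope classical_set_scope.
Local Open Scope card_scope.

(** * First-order logic *)

Record language := Language {
  fsym : Type; farity : fsym -> nat;
  rsym : Type; rarity : rsym -> nat }.

(* Formulas are well scoped: the free variables of [phi : formula L n] are
   among x_0, ..., x_{n-1}, so that no parameter can enter a 0-definable set
   through the value of a spare variable.  [FAll] binds x_0 and shifts the
   other variables. *)
Inductive term (L : language) (n : nat) : Type :=
| TVar of 'I_n
| TApp (f : fsym L) of ('I_(farity f) -> term L n).

Inductive formula (L : language) : nat -> Type :=
| FFalse n : formula L n
| FEq n of term L n & term L n : formula L n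
| FRel n (r : rsym L) of ('I_(rarity r) -> term L n) : formula L n
| FImp n of formula L n & formula L n : formula L n
| FAll n of formula L n.+1 : formula L n.

Record structure (L : language) := Structure {
  carrier :> Type;
  interp_f : forall f : fsym L, (farity f).-tuple carrier -> carrier;
  interp_r : forall r : rsym L, set ((rarity r).-tuple carrier) }.
Arguments interp_f {L s} f.
Arguments interp_r {L s} r.

Fixpoint teval (L : language) (M : structure L) (n : nat) (v : n.-tuple M)
    (t : term L n) : M :=
  match t with
  | TVar i => tnth v i
  | TApp f ts => interp_f f (mktuple (fun i => teval v (ts i)))
  end.

Fixpoint sat (L : language) (M : structure L) (n : nat) (phi : formula L n) :
    set (n.-tuple M) :=
  match phi with
  | FFalse _ => fun _ => False
  | FEq _ t u => fun v => teval v t = teval v u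
  | FRel _ r ts => fun v => interp_r r (mktuple (fun i => teval v (ts i)))
  | FImp _ psi chi => fun v => sat psi v -> sat chi v
  | FAll _ psi => fun v => forall a : M, sat psi (cons_tuple a v)
  end.

Definition definable (L : language) (M : structure L) (n : nat)
    (D : set (n.-tuple M)) : Prop :=
  exists phi : formula L n, D = [set x | sat phi x].

Definition type_definable (L : language) (M : structure L) (n : nat)
    (D : set (n.-tuple M)) : Prop :=
  exists p : set (formula L n), D = [set x | forall phi, p phi -> sat phi x].

Record automorphism (L : language) (M : structure L) (s : M -> M) : Prop := {
  aut_bij : bijective s;
  aut_fun : forall (f : fsym L) (a : (farity f).-tuple M),
    s (interp_f f a) = interp_f f (map_tuple s a);
  aut_rel : forall (r : rsym L) (a : (rarity r).-tuple M),
    interp_r r (map_tuple s a) <-> interp_r r a }.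

(** * Monster models *)

(* The cardinal kappa is given by a type [K] of that cardinality;
   [bounded K A] says |A| < kappa. *)
Definition bounded (K T : Type) (A : set T) : Prop := ~ ([set: K] #<= A).

(* L_M-formulas in the variables x_0, ..., x_{n-1} *)
Record pformula (L : language) (M : structure L) (n : nat) := PFormula {
  pnum : nat;
  pform : formula L (n + pnum);
  params : pnum.-tuple M }.

Definition pformula_over (L : language) (M : structure L) (n : nat)
    (A : set M) : set (pformula M n) :=
  [set phi | forall i, A (tnth (params phi) i)].

Definition psat (L : language) (M : structure L) (n : nat)
    (phi : pformula M n) : set (n.-tuple M) :=
  [set x | sat (pform phi) (cat_tuple x (params phi))].

Definition saturated (K : Type) (L : language) (M : structure L) : Prop :=
  forall (A : set M) (n : nat) (p : set (pformula M n)),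
    bounded K A -> p `<=` pformula_over A ->
    (forall q : set (pformula M n), finite_set q -> q `<=` p ->
       exists x, forall phi, q phi -> psat phi x) ->
    exists x, forall phi, p phi -> psat phi x.

Definition elementary_on (L : language) (M : structure L) (A : set M)
    (f : M -> M) : Prop :=
  forall (n : nat) (phi : formula L n) (a : n.-tuple M),
    (forall i, A (tnth a i)) -> (sat phi a <-> sat phi (map_tuple f a)).

Definition strongly_homogeneous (K : Type) (L : language) (M : structure L) :
    Prop :=
  forall (A : set M) (f : M -> M), bounded K A -> elementary_on A f ->
    exists2 s : M -> M, automorphism s & forall a, A a -> s a = f a.

(* [monster_large] makes "kappa is sufficiently large" explicit: it reads
   2 ^ (|L| + aleph_0) < kappa, as there are |L| + aleph_0 formulas. *)
Record monster (K : Type) (L : language) (M : structure L) : Prop := {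
  monster_large : bounded K [set: set {n : nat & formula L n}];
  monster_saturated : saturated K M;
  monster_homogeneous : strongly_homogeneous K M }.

(** * Subsets of groups *)

Section GroupSets.
Variable G : groupType.
Implicit Types A B X Y S : set G.
Local Open Scope group_scope.

Definition subgroup S : Prop :=
  [/\ S 1, forall x y, S x -> S y -> S (x * y) & forall x, S x -> S x^-1].

Definition generated X : set G := smallest subgroup X.

Definition set_mul A B : set G := [set x * y | x in A & y in B].

Definition set_pow Y (m : nat) : set G := iter m (set_mul Y) [set 1].

Definition translate (g : G) A : set G := [set g * x | x in A].

Definition symmetric_set Y : Prop := [set y^-1 | y in Y] = Y /\ Y 1.

Definition approximate_subgroup X : Prop :=
  symmetric_set X /\
  exists2 F : set G, finite_set F &
    set_mul X X `<=` \bigcup_(g in F) translate g X.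

Definition generic X Y : Prop :=
  exists F : set G, [/\ finite_set F, F `<=` generated X &
    X `<=` \bigcup_(h in F) translate h Y].

(* |H / S| < kappa *)
Definition bounded_index (K : Type) (H S : set G) : Prop :=
  bounded K [set translate h S | h in H].

End GroupSets.

Definition is_smallest (T : Type) (P : set T -> Prop) (S : set T) : Prop :=
  P S /\ forall S', P S' -> S `<=` S'.

(** * Definable groups *)

(* A definable group in [M] is an abstract group [G] identified, through an
   injection [iota], with a definable subset of some M^n on which the group
   operation has a definable graph. *)
Section DefinableGroup.
Variables (L : language) (M : structure L) (G : groupType) (n : nat).
Variable iota : G -> n.-tuple M.
Implicit Types D H S X Y : set G.
Local Open Scope group_scope.

Definition definable_group : Prop :=
  [/\ injective iota, definable (range iota) &
      definable [set cat_tuple (iota g) (cat_tuple (iota h) (iota (g * h)))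
                | g in [set: G] & h in [set: G]]].

Definition gdefinable D : Prop := definable (iota @` D).

Definition gtype_definable D : Prop := type_definable (iota @` D).

Definition invariant D : Prop :=
  forall s : M -> M, automorphism s ->
    map_tuple s @` (iota @` D) = iota @` D.

Definition is_H000 (K : Type) H : set G -> Prop :=
  is_smallest (fun S => [/\ subgroup S, S `<=` H, invariant S &
                            bounded_index K H S]).

Definition is_H00 (K : Type) H : set G -> Prop :=
  is_smallest (fun S => [/\ subgroup S, S `<=` H, gtype_definable S &
                            bounded_index K H S]).

Definition generic_symmetric X Y : Prop :=
  [/\ Y `<=` generated X, gdefinable Y, generic X Y & symmetric_set Y].

End DefinableGroup.

(* Main.v *)
(* Write R_m for the intersection of the sets Y^m over all 0-definable generic
   symmetric Y ([core m] below).  It is type-definable, and R_2 generates a subgroup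
   of bounded index of H: the coset of h is determined by the translates of the
   sets Y that contain h.

   Conversely every invariant subgroup S of H of bounded index contains every R_m.
   Call a 0-definable symmetric D, with 1 not in D, thin if there is a bound on the
   size of the subsets of X whose distinct elements satisfy [a^-1 b \in D].  By
   Ramsey, thin sets form an ideal, and [X^2 \ D] is generic when D is thin.  If u is
   not in S, some thin D contains u: otherwise saturation gives a subset C of X of
   size kappa such that, for distinct a, b in C, [a^-1 b] has the type of u or of
   u^-1, whence the cosets aS (a in C) are distinct.  So the sets [X^2 \ D], D thin,
   are a directed family of generic sets with intersection inside S, and by compactness
   R_m, which lies in all their m-th powers, is inside S^m = S.

   Hence H^000 = <R_2>.  This gives (2) => (3), and (3) => (1) as H^000 = R_m in (3).
   For (1) => (2), the type-definable group H^000 is the union of its intersections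
   with the R_m, and Newelski's Baire category argument puts it inside one R_m. *)
Require Import Defs.
From mathcomp Require Import all_boot.
From mathcomp Require Import mathcomp_extra boolp classical_sets functions.
From mathcomp Require Import cardinality.
From Stdlib Require Eqdep_dec.

Set Implicit Arguments.
Unset Strict Implicit.
Unset Printing Implicit Defensive.

Local Open Scope classical_set_scope.

(** * Substitution and automorphisms *)

Section Renaming.
Variable L : language.

Fixpoint tren (n m : nat) (r : 'I_n -> 'I_m) (t : term L n) : term L m :=
  match t with
  | TVar i => TVar L (r i)
  | TApp f ts => TApp (fun i => tren r (ts i))
  end.

Definition lift_ren (n m : nat) (r : 'I_n -> 'I_m) (i : 'I_n.+1) : 'I_m.+1 :=
  if unlift ord0 i is Some j then lift ord0 (r j) else ord0.

(** The target arity is quantified after the formula because it grows under [FAll]. Renamings need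
    not be injective: they add dummy variables and also identify variables. *)
Fixpoint fren (n : nat) (phi : formula L n) :
    forall m, ('I_n -> 'I_m) -> formula L m :=
  match phi with
  | FFalse _ => fun m _ => FFalse L m
  | FEq _ t u => fun m r => FEq (tren r t) (tren r u)
  | FRel _ s ts => fun m r => FRel (fun i => tren r (ts i))
  | FImp _ psi chi => fun m r => FImp (fren psi r) (fren chi r)
  | FAll _ psi => fun m r => FAll (fren psi (lift_ren r))
  end.

Variable M : structure L.

Definition sel (n m : nat) (r : 'I_n -> 'I_m) (v : m.-tuple M) : n.-tuple M :=
  mktuple (fun i => tnth v (r i)).

Lemma teval_ren n m (r : 'I_n -> 'I_m) (v : m.-tuple M) (t : term L n) :
  teval v (tren r t) = teval (sel r v) t.
Proof.
elim: t => [i|f ts IH] /=; first by rewrite tnth_mktuple.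
by congr interp_f; apply: eq_mktuple => i; rewrite IH.
Qed.

Lemma sel_cons n m (r : 'I_n -> 'I_m) (v : m.-tuple M) a :
  sel (lift_ren r) (cons_tuple a v) = cons_tuple a (sel r v).
Proof.
apply: eq_from_tnth => i; rewrite tnth_mktuple /lift_ren.
case: unliftP => [j ->|->]; last by rewrite !tnth0.
by rewrite !tnthS tnth_mktuple.
Qed.

Lemma sat_ren n (phi : formula L n) m (r : 'I_n -> 'I_m) (v : m.-tuple M) :
  sat (fren phi r) v <-> sat phi (sel r v).
Proof.
elim: phi m r v => {n} [n|n t u|n s ts|n psi IH1 chi IH2|n psi IH] m r v //=.
- by rewrite !teval_ren.
- suff -> : mktuple (fun i => teval v (tren r (ts i))) =
    mktuple (fun i => teval (sel r v) (ts i)) by [].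
  by apply: eq_mktuple => i; rewrite teval_ren.
- by rewrite IH1 IH2.
- by split=> H a; have := H a; rewrite IH sel_cons.
Qed.

Definition fand n (phi psi : formula L n) :=
  FImp (FImp phi (FImp psi (FFalse L n))) (FFalse L n).

Lemma sat_fand n (phi psi : formula L n) (v : n.-tuple M) :
  sat (fand phi psi) v <-> sat phi v /\ sat psi v.
Proof.
split=> [/= H|[? ?] /=]; last exact.
by apply: contrapT => H'; apply: H => ? ?; apply: H'.
Qed.

Fixpoint falln (m k : nat) : formula L (m + k) -> formula L k :=
  match m with
  | 0 => fun phi => phi
  | m'.+1 => fun phi : formula L (m' + k).+1 => falln (FAll phi)
  end.

Lemma sat_falln m k (phi : formula L (m + k)) (v : k.-tuple M) :
  sat (falln phi) v <-> forall x : m.-tuple M, sat phi (cat_tuple x v).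
Proof.
elim: m phi => [|m IH] phi.
  have E (x : 0.-tuple M) : cat_tuple x v = v by apply: val_inj; rewrite tuple0.
  split=> [H x|/(_ [tuple])]; first by rewrite E.
  by rewrite E.
have E (x : m.-tuple M) a :
  cat_tuple (cons_tuple a x) v = cons_tuple a (cat_tuple x v) by exact: val_inj.
rewrite /=; split=> [H x|H]; last first.
  by rewrite (IH (FAll phi)) => x a; rewrite -E; exact: H.
by case/tupleP: x => a x; rewrite E; move: H; rewrite (IH (FAll phi)); exact.
Qed.

Lemma aut_teval (s : M -> M) : automorphism s ->
  forall n (v : n.-tuple M) (t : term L n),
    teval (map_tuple s v) t = s (teval v t).
Proof.
move=> hs n v; elim=> [i|f ts IH] /=; first by rewrite tnth_map.
rewrite (aut_fun hs); congr interp_f; apply: eq_from_tnth => i.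
by rewrite [RHS]tnth_map !tnth_mktuple IH.
Qed.

Lemma aut_sat (s : M -> M) : automorphism s ->
  forall n (phi : formula L n) (v : n.-tuple M),
    sat phi (map_tuple s v) <-> sat phi v.
Proof.
move=> hs n; elim=> {n} [n|n t u|n r ts|n psi IH1 chi IH2|n psi IH] v //=.
- by rewrite !(aut_teval hs); split=> [/(bij_inj (aut_bij hs))|->].
- suff -> : mktuple (fun i => teval (map_tuple s v) (ts i)) =
    map_tuple s (mktuple (fun i => teval v (ts i))) by exact: aut_rel hs _ _.
  by apply: eq_from_tnth => i; rewrite [RHS]tnth_map !tnth_mktuple (aut_teval hs).
- by rewrite IH1 IH2.
- have E a : map_tuple s (cons_tuple a v) = cons_tuple (s a) (map_tuple s v).
    exact: val_inj.
  have [s' s's ss'] := aut_bij hs.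
  split=> H a; first by apply/IH; rewrite E; exact: H.
  by rewrite -(ss' a) -E; apply/IH; exact: H.
Qed.

End Renaming.

(** * Definable relations on a definable group *)

Lemma cat_tuple_inj (T : Type) a b (x y : a.-tuple T) (x' y' : b.-tuple T) :
  cat_tuple x x' = cat_tuple y y' -> x = y /\ x' = y'.
Proof.
move=> /(congr1 val)/= E; split; apply: val_inj => /=.
  by have := congr1 (take a) E; rewrite !take_size_cat ?size_tuple.
by have := congr1 (drop a) E; rewrite !drop_size_cat ?size_tuple.
Qed.

Definition scons (T : Type) (x : T) (w : nat -> T) (i : nat) : T :=
  if i is j.+1 then w j else x.

Section Calculus.
Variables (L : language) (M : structure L) (G : groupType) (n : nat).
Variable iota : G -> n.-tuple M.
Hypothesis hG : definable_group iota.
Local Open Scope group_scope.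

Let iota_inj : injective iota. Proof. by case: hG. Qed.

Fixpoint flat (k : nat) (w : nat -> G) : (k * n).-tuple M :=
  match k with
  | 0 => [tuple]
  | k'.+1 => cat_tuple (iota (w 0)) (flat k' (fun i => w i.+1))
  end.

Lemma flat_coord k (i : 'I_(k * n)) :
  exists m j, m < k /\ forall w, tnth (flat k w) i = tnth (iota (w m)) j.
Proof.
elim: k i => [[]//|k IH] i.
case: (fintype.splitP (i : 'I_(n + k * n))) => j ij.
  exists 0, j; split=> // w /=; rewrite (_ : i = lshift (k * n) j) ?tnth_lshift //.
  exact: val_inj.
have [m [j' [mk H]]] := IH j; exists m.+1, j'; split=> // w /=.
rewrite (_ : i = rshift n j) ?tnth_rshift //; exact: val_inj.
Qed.

Lemma coord_flat k m (j : 'I_n) : m < k ->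
  exists i : 'I_(k * n), forall w, tnth (flat k w) i = tnth (iota (w m)) j.
Proof.
elim: k m => [//|k IH] [_|m /IH [i Hi]].
  by exists (lshift (k * n) j) => w /=; rewrite tnth_lshift.
by exists (rshift n i) => w /=; rewrite tnth_rshift.
Qed.

(** Each coordinate of [flat k w] is a fixed coordinate of a fixed entry of [w], whatever [w] is; so
    a substitution of group variables is a renaming of variables in [M]. *)
Lemma flat_sel k k' (r : nat -> nat) : (forall i, i < k -> r i < k') ->
  exists rho : 'I_(k * n) -> 'I_(k' * n),
    forall w, flat k (fun i => w (r i)) = sel rho (flat k' w).
Proof.
move=> rP.
have /choice[rho Hrho] : forall i : 'I_(k * n), exists i' : 'I_(k' * n),
    forall w, tnth (flat k (fun i => w (r i))) i = tnth (flat k' w) i'.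
  move=> i; have [m [j [mk H]]] := flat_coord i.
  have [i' Hi'] := coord_flat j (rP _ mk).
  by exists i' => w; rewrite H Hi'.
exists rho => w; apply: eq_from_tnth => i.
by rewrite tnth_mktuple Hrho.
Qed.

(* Relations on [G] are predicates of an environment [w : nat -> G], so that
   quantifiers and substitutions need no arithmetic on arities. *)
Definition gdk k (P : (nat -> G) -> Prop) :=
  exists phi : formula L (k * n), forall w, P w <-> sat phi (flat k w).

Definition gd (P : (nat -> G) -> Prop) := exists k, gdk k P.

Lemma gdk_subst k k' r P : (forall i, i < k -> r i < k') -> gdk k P ->
  gdk k' (fun w => P (fun i => w (r i))).
Proof.
move=> /flat_sel[rho Hrho] [phi Hphi]; exists (fren phi rho) => w.
by rewrite sat_ren -Hrho.
Qed.

Lemma gdk_le k k' P : k <= k' -> gdk k P -> gdk k' P.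
Proof.
by move=> kk'; apply: (@gdk_subst k k' id) => i /leq_trans; exact.
Qed.

Lemma gd_ext P Q : (forall w, P w <-> Q w) -> gd P -> gd Q.
Proof. by move=> PQ [k [phi H]]; exists k, phi => w; rewrite -PQ. Qed.

Lemma gd_true : gd (fun _ => True).
Proof.
exists 0, (FImp (FFalse L (0 * n)) (FFalse L (0 * n))) => w /=; tauto.
Qed.

Lemma gd_imp P Q : gd P -> gd Q -> gd (fun w => P w -> Q w).
Proof.
move=> [k hP] [k' hQ].
have [phi Hphi] := gdk_le (leq_maxl k k') hP.
have [psi Hpsi] := gdk_le (leq_maxr k k') hQ.
by exists (maxn k k'), (FImp phi psi) => w /=; rewrite Hphi Hpsi.
Qed.

Lemma gd_not P : gd P -> gd (fun w => ~ P w).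
Proof.
move=> [k [phi Hphi]]; exists k, (FImp phi (FFalse L _)) => w /=.
by rewrite Hphi.
Qed.

Lemma gd_and P Q : gd P -> gd Q -> gd (fun w => P w /\ Q w).
Proof.
move=> hP hQ; apply: gd_ext (gd_not (gd_imp hP (gd_not hQ))) => w.
split=> [H|[p q] H]; last exact: H p q.
by split; apply: contrapT => H'; apply: H.
Qed.

Lemma gd_or P Q : gd P -> gd Q -> gd (fun w => P w \/ Q w).
Proof.
move=> hP hQ; apply: gd_ext (gd_imp (gd_not hP) hQ) => w.
split=> [H|[//|q _ //]].
by have [p|p] := pselect (P w); [left|right; exact: H].
Qed.

Lemma gd_subst r P : gd P -> gd (fun w => P (fun i => w (r i))).
Proof.
move=> [k hP]; exists (\max_(i < k) (r i).+1).
apply: gdk_subst hP => i ik.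
exact: (@leq_bigmax _ (fun i : 'I_k => (r i).+1) (Ordinal ik)).
Qed.

Lemma gd_all P : gd P -> gd (fun w => forall g, P (scons g w)).
Proof.
move=> [k hP]; have [phi Hphi] := gdk_le (leqnSn k) hP.
have [rg Hrg] : definable (range iota) by case: hG.
have Hr x : range iota x <-> sat rg x by rewrite Hrg.
(* A quantifier over [G] is a block of [n] quantifiers over [M], relativised to the 0-definable
   range of [iota]. *)
exists k, (falln (FImp (fren rg (@lshift n (k * n))) (phi : formula L (n + k * n)))) => w.
rewrite sat_falln; have E x : sel (@lshift n (k * n)) (cat_tuple x (flat k w)) = x.
  by apply: eq_from_tnth => i; rewrite tnth_mktuple tnth_lshift.
split=> [H x /=|H g]; first rewrite sat_ren E -Hr => -[g _ <-].
  by have := H g; rewrite Hphi.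
have /= := H (iota g); rewrite sat_ren E -Hr => /(_ (imageT _ _)).
by rewrite Hphi.
Qed.

Lemma gd_ex P : gd P -> gd (fun w => exists g, P (scons g w)).
Proof.
move=> hP; apply: gd_ext (gd_not (gd_all (gd_not hP))) => w.
by split=> [/existsNP[g /contrapT Pg]|[g Pg] /(_ g)]; [exists g | apply].
Qed.

Lemma gd_lt k (P : nat -> (nat -> G) -> Prop) : (forall i, gd (P i)) ->
  gd (fun w => forall i, i < k -> P i w).
Proof.
move=> hP; elim: k => [|k IH]; first by apply: gd_ext gd_true => w.
apply: gd_ext (gd_and IH (hP k)) => w; split=> [[H Hk] i|H].
  by rewrite ltnS leq_eqVlt => /orP[/eqP->//|/H].
by split=> [i /ltnW ik|]; exact: H.
Qed.

Lemma gd_mulg : gd (fun w => w 0 * w 1%N = w 2).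
Proof.
have [_ _ [phi Hphi]] := hG.
have E : (n + (n + n) = 3 * n)%N by rewrite /= !mulSn mul0n addn0.
exists 3, (fren phi (cast_ord E)) => w; rewrite sat_ren.
have -> : sel (cast_ord E) (flat 3 w) =
    cat_tuple (iota (w 0)) (cat_tuple (iota (w 1%N)) (iota (w 2))).
  apply: eq_from_tnth => i; rewrite tnth_mktuple.
  have x0 : M := tnth (flat 3 w) (cast_ord E i).
  by rewrite !(tnth_nth x0) /= cats0.
have -> (x : (n + (n + n)).-tuple M) : sat phi x =
    ([set cat_tuple (iota g) (cat_tuple (iota h) (iota (g * h)))
                | g in [set: G] & h in [set: G]] x) by rewrite Hphi.
split=> [<-|]; first by exists (w 0) => //; exists (w 1%N).
move=> [g _ [h _ /cat_tuple_inj[/iota_inj <- /cat_tuple_inj[/iota_inj <- /iota_inj <-]]]].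
by [].
Qed.

Definition gset (D : set G) := gd (fun w => D (w 0)).

(* Closure under composition, which makes iterated products immediate. *)
Definition gterm (t : (nat -> G) -> G) := forall r P, gd P ->
  gd (fun w => P (scons (t (fun i => w (r i))) w)).

Lemma gd_scons t r P : gterm t -> gd P ->
  gd (fun w => P (scons (t w) (fun i => w (r i)))).
Proof.
move=> ht hP.
have := ht id _ (gd_subst (fun i => if i is j.+1 then (r j).+1 else 0) hP).
by apply: gd_ext => w; split; congr P; apply/funext=> -[].
Qed.

Lemma gd_in D t : gset D -> gterm t -> gd (fun w => D (t w)).
Proof. by move=> hD ht; exact: (ht id _ hD). Qed.

Lemma gterm_var i : gterm (fun w => w i).
Proof.
move=> r P hP.
have := gd_subst (fun j => if j is j'.+1 then j' else r i) hP.
by apply: gd_ext => w; split; congr P; apply/funext=> -[].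
Qed.

Lemma gterm_mul t u : gterm t -> gterm u -> gterm (fun w => t w * u w).
Proof.
move=> ht hu r P hP.
have hR : gd (fun w => exists g, w 1%N * w 0 = g /\ P (scons g (fun i => w i.+2))).
  have := gd_ex (gd_and (gd_subst (fun i => if i is 0 then 2 else 2 - i) gd_mulg)
    (gd_subst (fun i => if i is j.+1 then j.+3 else 0) hP)).
  apply: gd_ext => w; split=> -[g [h Pg]]; exists g; split=> //; move: Pg;
    by congr P; apply/funext=> -[].
have := ht r _ (hu (fun i => (r i).+1) _ hR).
by apply: gd_ext => w; split=> [[g [/= <-]]//|H]; eexists; split.
Qed.

(** Equality is obtained from the product: [e * e = e] forces [e = 1], so [t = u] says that
    [t * e = u] for an idempotent [e]. *)
Lemma gd_eq t u : gterm t -> gterm u -> gd (fun w => t w = u w).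
Proof.
move=> ht hu.
have h1 : gd (fun w => exists e, e * e = e /\ w 0 * e = w 1%N).
  have := gd_ex (gd_and (gd_subst (fun i => 0) gd_mulg)
    (gd_subst (fun i => if i is j.+1 then if j is 0 then 0 else 2 else 1%N) gd_mulg)).
  exact: gd_ext.
have := ht id _ (hu S _ (gd_subst
  (fun i => if i is j.+1 then if j is 0 then 0 else i else 1%N) h1)).
apply: gd_ext => w; split=> /= [[e [/(canRL (mulKg _))]]|->].
  by rewrite mulVg => ->; rewrite mulg1.
by exists 1; rewrite !mulg1.
Qed.

Lemma gterm_def t (R : (nat -> G) -> Prop) (hR : gd R)
  (tR : forall g w, R (scons g w) <-> t w = g) : gterm t.
Proof.
move=> r P hP.
have := gd_ex (gd_and (gd_subst (fun i => if i is j.+1 then (r j).+1 else 0) hR) hP).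
have E g w : (fun i => scons g w (if i is j.+1 then (r j).+1 else 0)) =
     scons g (fun i => w (r i)) by apply/funext=> -[].
apply: gd_ext => w; split=> [[g []]|H]; first by rewrite E tR => ->.
by eexists; split; last exact: H; rewrite E tR.
Qed.

Lemma gterm_one : gterm (fun _ => 1).
Proof.
apply: (gterm_def (gd_eq (gterm_mul (gterm_var 0) (gterm_var 0)) (gterm_var 0))) => g w /=.
split=> [/(canRL (mulKg _))|<-]; last by rewrite mulg1.
by rewrite mulVg.
Qed.

Lemma gterm_inv t : gterm t -> gterm (fun w => (t w)^-1).
Proof.
move=> ht.
have ht' : gterm (fun w => t (fun i => w i.+1)).
  by move=> r P hP; exact: (ht (fun i => r i.+1)).
apply: (gterm_def (gd_eq (gterm_mul (gterm_var 0) ht') gterm_one)) => g w /=.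
split=> [/(canRL (mulgK _))|<-]; last by rewrite mulVg.
by rewrite mul1g.
Qed.

Lemma gset_inv D : gset D -> gset [set g | D g^-1].
Proof. by move=> hD; apply: gd_in hD _; apply/gterm_inv/gterm_var. Qed.

Lemma gset_mul A B : gset A -> gset B -> gset (set_mul A B).
Proof.
move=> hA hB.
have := gd_ex (gd_ex (gd_and (gd_in hA (gterm_var 0)) (gd_and (gd_in hB (gterm_var 1))
  (gd_eq (gterm_mul (gterm_var 0) (gterm_var 1)) (gterm_var 2))))).
apply: gd_ext => w; split=> /=.
  by move=> [y [x [xA [yB <-]]]]; exists x => //; exists y.
by move=> [x xA [y yB <-]]; exists y, x.
Qed.

Lemma gset_pow A m : gset A -> gset (set_pow A m).
Proof.
move=> hA; elim: m => [|m IH]; last exact: gset_mul hA IH.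
exact: gd_eq (gterm_var 0) gterm_one.
Qed.

Lemma gset_gdefinable D : gset D <-> gdefinable iota D.
Proof.
split=> [[k hD]|[phi Hphi]]; last first.
  exists 1%N, (fren phi (@lshift n 0) : formula L (1 * n)%N) => w; rewrite sat_ren.
  have -> : sel (@lshift n 0) (flat 1%N w) = iota (w 0).
    by apply: eq_from_tnth => i; rewrite tnth_mktuple tnth_lshift.
  have -> x : sat phi x = (iota @` D) x by rewrite Hphi.
  by split=> [|[g Dg /iota_inj <-]]//; exact: imageP.
(* The formula at hand has some number [k] of group variables; substituting variable 0 for all of
   them leaves the predicate unchanged and makes the formula unary. *)
have [psi Hpsi] : gdk 1%N (fun w => D (w 0)).
  by apply: (@gdk_subst k 1%N (fun=> 0) (fun w => D (w 0))).
have [rg Hrg] : definable (range iota) by case: hG.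
have E : (1 * n = n)%N by rewrite mul1n.
exists (fand rg (fren psi (cast_ord E))).
apply/predeqP => x; rewrite /mkset sat_fand sat_ren.
have -> y : sat rg y = (range iota) y by rewrite Hrg.
have Ex g : D g <-> sat psi (sel (cast_ord E) (iota g)).
  rewrite (Hpsi (fun=> g)); suff -> : flat 1%N (fun=> g) = sel (cast_ord E) (iota g) by [].
  apply: eq_from_tnth => i; rewrite tnth_mktuple.
  have x0 : M := tnth (iota g) (cast_ord E i).
  by rewrite !(tnth_nth x0) /= cats0.
split=> [[g Dg <-]|[[g _ <-] Hg]]; last by exists g => //; apply/Ex.
by split; [exact: imageT | apply/Ex].
Qed.
End Calculus.

(** * Saturation and homogeneity *)

Lemma card_le_inj (T U : Type) (A : set T) (B : set U) (f : T -> U) :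
  (forall x y, A x -> A y -> f x = f y -> x = y) ->
  (forall x, A x -> B (f x)) -> (A #<= B)%card.
Proof.
move=> fI fAB; apply: (@card_le_trans _ _ _ (f @` A)).
  have /card_eqPle[_ //] : (f @` A #= A)%card; apply: inj_card_eq.
  by move=> x y /set_mem Ax /set_mem Ay; exact: fI.
by apply: subset_card_le => _ [x Ax <-]; exact: fAB.
Qed.

Definition fip (T : Type) (F : set (set T)) :=
  forall s : seq (set T), (forall B, B \in s -> F B) ->
    exists x, forall B, B \in s -> B x.

Lemma fip_directed (T : Type) (F : set (set T)) : F !=set0 ->
  (forall B, F B -> B !=set0) ->
  (forall A B, F A -> F B -> exists2 C, F C & C `<=` A `&` B) -> fip F.
Proof.
move=> [B0 FB0] Fne Fdir s Fs.
suff [C FC Cs] : exists2 C, F C & forall B, B \in s -> C `<=` B.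
  by have [x Cx] := Fne _ FC; exists x => B /Cs; exact.
elim: s Fs => [_|A s IH Fs]; first by exists B0.
have [|C FC Cs] := IH; first by move=> B Bs; apply: Fs; rewrite inE Bs orbT.
have [|D FD DAC] := Fdir _ _ (Fs A _) FC; first by rewrite inE eqxx.
exists D => // B; rewrite inE => /orP[/eqP->|/Cs CB] x /DAC[]//.
by move=> _ /CB.
Qed.

Section Monster.
Variables (L : language) (M : structure L) (K : Type) (G : groupType) (n : nat).
Variable iota : G -> n.-tuple M.
Hypotheses (hM : monster K M) (hG : definable_group iota).
Local Open Scope group_scope.

Let iota_inj : injective iota. Proof. by case: hG. Qed.

Lemma gset_sat (phi : formula L n) : gset iota [set g | sat phi (iota g)].
Proof.
exists 1%N, (fren phi (@lshift n 0) : formula L (1 * n)%N) => w; rewrite sat_ren.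
have -> // : sel (@lshift n 0) (flat iota 1%N w) = iota (w 0).
by apply: eq_from_tnth => i; rewrite tnth_mktuple tnth_lshift.
Qed.

Lemma gtype_definableP D : gtype_definable iota D <->
  exists F : set (set G), (forall B, F B -> gset iota B) /\
    D = [set g | forall B, F B -> B g].
Proof.
split=> [[p Hp]|[F [FD ->]]].
  exists [set B | exists2 phi, p phi & B = [set g | sat phi (iota g)]].
  split=> [B [phi _ ->]|]; first exact: gset_sat.
  apply/predeqP => g; have -> : D g <-> (iota @` D) (iota g).
    by split=> [|[h Dh /iota_inj <-]]//; exact: imageP.
  rewrite Hp; split=> [H _ [phi pphi ->]|H phi pphi]; first exact: H.
  by apply: (H [set g | sat phi (iota g)]); exists phi.
have [rg Hrg] : definable (range iota) by case: hG.
(* The formula [rg] ensures that a tuple satisfying the type comes from [G], even when [F] is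
   empty. *)
exists [set phi | phi = rg \/ exists2 B, F B & iota @` B = [set x | sat phi x]].
apply/predeqP => x; split=> [[g Dg <-] phi [->|[B FB E]]|H].
- suff: (range iota) (iota g) by rewrite Hrg.
  exact: imageT.
- suff: (iota @` B) (iota g) by rewrite E.
  by exists g => //; exact: Dg.
- have : range iota x by rewrite Hrg; apply: H; left.
  move=> [g _ xg]; exists g => // B FB; have /(gset_gdefinable hG)[phi E] := FD _ FB.
  have : (iota @` B) x by rewrite E; apply: H; right; exists B.
  by rewrite -xg => -[h Bh /iota_inj <-].
Qed.

Definition lifts (s : M -> M) (sg : G -> G) :=
  forall g, iota (sg g) = map_tuple s (iota g).

(** An automorphism of [M] stabilises the 0-definable range of [iota], so it acts on [G]. *)
Lemma aut_lifts s : automorphism s ->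
  exists2 sg, lifts s sg & forall y, exists x, sg x = y.
Proof.
move=> hs; have [rg Hrg] : definable (range iota) by case: hG.
have rgP x : range iota (map_tuple s x) <-> range iota x.
  by rewrite Hrg /mkset aut_sat.
have /choice[sg Hsg] : forall g, exists g', iota g' = map_tuple s (iota g).
  move=> g; have [g' _ <-] : range iota (map_tuple s (iota g)).
    by apply/rgP; exact: imageT.
  by exists g'.
exists sg => // y; have [s' s's ss'] := aut_bij hs.
have E : map_tuple s (map_tuple s' (iota y)) = iota y.
  by apply: eq_from_tnth => i; rewrite !tnth_map ss'.
have [x _ Hx] : range iota (map_tuple s' (iota y)).
  by apply/rgP; rewrite E; exact: imageT.
by exists x; apply: iota_inj; rewrite Hsg Hx E.
Qed.

Lemma flat_lifts s sg k w : lifts s sg ->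
  flat iota k (sg \o w) = map_tuple s (flat iota k w).
Proof.
move=> sgP; apply: eq_from_tnth => i; rewrite tnth_map.
by have [m [j [_ H]]] := flat_coord iota i; rewrite !H /= sgP tnth_map.
Qed.

Lemma gd_aut s sg P w : automorphism s -> lifts s sg -> gd iota P ->
  P (sg \o w) <-> P w.
Proof.
by move=> hs sgP [k [phi Hphi]]; rewrite !Hphi (flat_lifts _ _ sgP) aut_sat.
Qed.

Lemma lifts_mul s sg : automorphism s -> lifts s sg ->
  {morph sg : x y / x * y >-> x * y}.
Proof.
move=> hs sgP x y.
pose w i := if i is j.+1 then if j is 0 then y else x * y else x.
have /= <- // := (gd_aut w hs sgP (gd_mulg hG)).2.
Qed.

(* Unqualified, [invariant] is that of [eqtype]. *)
Lemma invariantP D : Defs.invariant iota D <->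
  forall s sg, automorphism s -> lifts s sg -> forall g, D (sg g) <-> D g.
Proof.
split=> [Dinv s sg hs sgP g|H s hs].
  have s_inj := bij_inj (aut_bij hs).
  have -> : D (sg g) <-> (iota @` D) (iota (sg g)).
    by split=> [|[h Dh /iota_inj <-]]//; exact: imageP.
  rewrite -(Dinv _ hs) sgP; split=> [[_ [h Dh <-]]|Dg]; last first.
    by exists (iota g) => //; exact: imageP.
  move=> E; suff /iota_inj <- : iota h = iota g by [].
  apply: eq_from_tnth => i; apply: s_inj.
  by have /(congr1 (fun t => tnth t i)) := E; rewrite !tnth_map.
have [sg sgP sgS] := aut_lifts hs; have {}H := H _ _ hs sgP.
apply/seteqP; split=> [_ [_ [g Dg <-] <-]|_ [y Dy <-]].
  by rewrite -sgP; apply: imageP; apply/H.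
have [x xy] := sgS y; exists (iota x); last by rewrite -sgP xy.
by apply: imageP; apply/H; rewrite xy.
Qed.

Lemma gset_invariant D : gset iota D -> Defs.invariant iota D.
Proof.
by move=> hD; apply/invariantP => s sg hs sgP g; exact: (gd_aut (fun=> g) hs sgP hD).
Qed.

Lemma gtype_definable_invariant D : gtype_definable iota D -> Defs.invariant iota D.
Proof.
move=> /gtype_definableP[F [FD ->]]; apply/invariantP => s sg hs sgP g.
split=> H B FB; have /invariantP-/(_ _ _ hs sgP g) := gset_invariant (FD _ FB).
  by move=> <-; exact: H.
by move=> ->; exact: H.
Qed.

(** There is a formula [FFalse] in each arity, so a countable set embeds in the power set of the set
    of formulas, whose cardinality is below kappa. *)
Lemma countable_bounded (T : Type) (A : set T) : countable A -> bounded K A.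
Proof.
move=> cA KA; apply: (monster_large hM).
apply: (card_le_trans (card_le_trans KA cA)).
pose f (k : nat) := [set existT (formula L) k (FFalse L k)].
apply: (@card_le_inj _ _ _ _ f) => // x y _ _ E.
have : f y (existT (formula L) x (FFalse L x)) by rewrite -E.
by move=> /(congr1 (@projT1 _ _)).
Qed.

Definition coords (C : set G) : set M :=
  [set m | exists c i, C c /\ m = tnth (iota c) i].

Lemma coords_countable C : countable C -> countable (coords C).
Proof.
move=> cC; have : coords C `<=` \bigcup_(c in C) [set tnth (iota c) i | i in [set: 'I_n]].
  by move=> _ [c [i [Cc ->]]]; exists c => //; exists i.
move=> /subset_card_le /sub_countable; apply; apply: bigcup_countable => // c _.
apply: finite_set_countable; apply: finite_image; exact: finite_finset.
Qed.

Definition cdef (C B : set G) := exists P w,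
  [/\ gd iota P, forall i, C (w i) & B = [set x | P (scons x w)]].

(** Saturation read in [G]: the type consists of the formulas over [coords C] that define members of
    [F], together with [rgp], which makes the realisation the image of a group element. *)
Lemma saturation (C : set G) (F : set (set G)) :
  bounded K (coords C) -> (forall B, F B -> cdef C B) -> fip F ->
  exists x, forall B, F B -> B x.
Proof.
move=> bC FC Ffip.
have [rg Hrg] : definable (range iota) by case: hG.
have Hr x : range iota x <-> sat rg x by rewrite Hrg.
pose rgp := PFormula (fren rg (@lshift n 0)) ([tuple] : 0.-tuple M).
have rgpP x : psat rgp x <-> range iota x.
  rewrite Hr /psat /= sat_ren; suff -> : sel (@lshift n 0) (cat_tuple x [tuple]) = x by [].
  by apply: eq_from_tnth => i; rewrite tnth_mktuple tnth_lshift.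
pose p : set (pformula M n) := [set psi | psi = rgp \/
  pformula_over (coords C) psi /\ exists2 B, F B & B = [set g | psat psi (iota g)]].
have [||x xP] := monster_saturated hM (A := coords C) (p := p) bC.
- by move=> psi [->|[]//] [].
- move=> q fq qp.
  pose Q := [set [set g | psat psi (iota g)] | psi in q] `&` F.
  have /finite_seqP[s Qs] : finite_set Q by apply/finite_setIl/finite_image.
  have [|x xP] := Ffip s.
    by move=> B Bs; have [] : Q B by rewrite Qs.
  exists (iota x) => psi qpsi; have [->|[_ [B FB EB]]] := qp _ qpsi.
    by apply/rgpP; exact: imageT.
  suff : B x by rewrite EB.
  apply: xP; suff : Q B by rewrite Qs.
  by split=> //; exists psi.
- have /rgpP[g _ gx] : psat rgp x by apply: xP; left.
  exists g => B FB; have [P [w [[k hP] Cw EB]]] := FC _ FB.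
  have [phi Hphi] := gdk_le (leqnSn k) hP.
  pose psi := PFormula (phi : formula L (n + (k * n))) (flat iota k w).
  have psiB : B = [set g | psat psi (iota g)].
    by rewrite EB; apply/predeqP => h; rewrite /mkset Hphi.
  rewrite psiB /mkset gx; apply: xP; right; split; last by exists B.
  by move=> i; have [m [j [_ ->]]] := flat_coord iota i; exists (w m), j.
Qed.

Lemma homogeneity u x : (forall D, gset iota D -> D u -> D x) ->
  exists s sg, [/\ automorphism s, lifts s sg & sg u = x].
Proof.
move=> ux.
have uxE (phi : formula L n) : sat phi (iota u) <-> sat phi (iota x).
  split; first exact: (ux _ (gset_sat phi)).
  by move=> xphi; apply: contrapT => /(ux [set g | ~ sat phi (iota g)] (gd_not (gset_sat phi))).
pose A := [set tnth (iota u) i | i in [set: 'I_n]].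
(* Equal coordinates of [u] match equal coordinates of [x], since the formula equating them holds of
   [u]; hence the map from one tuple to the other is well defined. *)
have /choice[f Hf] : forall m, exists m', forall i, m = tnth (iota u) i -> m' = tnth (iota x) i.
  move=> m; have [[i mi]|H] := pselect (exists i, m = tnth (iota u) i).
    exists (tnth (iota x) i) => j; rewrite mi => E.
    exact: (uxE (FEq (TVar L i) (TVar L j))).1.
  by exists m => i mi; case: H; exists i.
have fux : map_tuple f (iota u) = iota x.
  by apply: eq_from_tnth => i; rewrite tnth_map; exact: Hf.
have bA : bounded K A.
  apply/countable_bounded/finite_set_countable/finite_image; exact: finite_finset.
have [|s hs Hs] := monster_homogeneous hM (f := f) bA.
  move=> k phi a aA.
  have /choice[r Hr] : forall i, exists j, tnth a i = tnth (iota u) j.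
    by move=> i; have [j _ <-] := aA i; exists j.
  have -> : a = sel r (iota u) by apply: eq_from_tnth => i; rewrite tnth_mktuple.
  have -> : map_tuple f (sel r (iota u)) = sel r (iota x).
    by apply: eq_from_tnth => i; rewrite tnth_map !tnth_mktuple -fux tnth_map.
  by rewrite -!sat_ren.
have [sg sgP _] := aut_lifts hs; exists s, sg; split=> //.
apply: iota_inj; rewrite sgP -fux; apply: eq_from_tnth => i.
by rewrite !tnth_map; apply: Hs; exists i.
Qed.

End Monster.

(** * Cardinality and Ramsey *)

(** For Zorn's lemma: a property of the finite parts of a set passes to unions of chains. The empty
    list is separate because the chain may be empty. *)
Lemma seq_sub_chain (T : eqType) (F : set (set T)) (s : seq T) :
  total_on F subset -> (forall x, x \in s -> (\bigcup_(A in F) A) x) ->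
  s = [::] \/ exists2 A, F A & forall x, x \in s -> A x.
Proof.
move=> Ftot; elim: s => [|x s IH] sF; [by left | right].
have [A FA Ax] := sF x (mem_head _ _).
have [|->|[B FB sB]] := IH; first by move=> y ys; apply: sF; rewrite inE ys orbT.
  by exists A => // y; rewrite inE => /eqP->.
have [AB|BA] := Ftot _ _ FA FB.
  by exists B => // y; rewrite inE => /orP[/eqP->|/sB//]; exact: AB.
by exists A => // y; rewrite inE => /orP[/eqP->//|/sB/BA].
Qed.

(* A maximal family of disjoint countable sequences in [A] exhausts [A] up to
   a finite set [R], so that [A] embeds into (family) x nat. *)
Lemma infinite_card_setXnat (T : eqType) (A : set T) :
  infinite_set A -> (A `*` [set: nat] #<= A)%card.
Proof.
move=> Ainf.
pose P (F : set (nat -> T)) := (forall f, F f -> injective f /\ forall i, A (f i)) /\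
  forall f g, F f -> F g -> forall i j, f i = g j -> f = g.
have [Fs FsP Fstot|F [[FA Fdisj] Fmax]] := @Zorn_bigcup _ P.
  split=> [f [F FsF Ff]|f g [F1 Fs1 F1f] [F2 Fs2 F2g]]; first exact: (FsP _ FsF).1.
  have [F12|F21] := Fstot _ _ Fs1 Fs2.
    by apply: (FsP _ Fs2).2 => //; exact: F12.
  by apply: (FsP _ Fs1).2 => //; exact: F21.
pose R := A `\` [set f i | f in F & i in [set: nat]].
have RF a : R a -> forall f i, F f -> f i <> a.
  by move=> [_ Ra] f i Ff fia; apply: Ra; exists f => //; exists i.
have Rfin : finite_set R.
  apply: contrapT => /infiniteP/card_leP[g].
  pose h (i : nat) : T := val (g (SigSub (mem_set (I : [set: nat] i)))).
  have hI : injective h.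
    move=> i j /val_inj /(@inj _ _ _ g) E.
    by have := E (mem_set I) (mem_set I) => /(congr1 val).
  have hR i : R (h i) by rewrite /h; case: (g _) => /= y /set_mem.
  have nFh : ~ F h by move=> Fh; exact: (RF _ (hR 0) h 0 Fh).
  apply: (Fmax (F `|` [set h])).
    by split=> [f Ff|]; [left | move=> /(_ h (or_intror erefl))].
  split=> [f [/FA//|->]|f1 f2 [F1|->] [F2|->] i j //].
  - by split=> // i; case: (hR i).
  - exact: Fdisj.
  - by move=> E; case: (RF _ (hR j) _ i F1).
  - by move=> /esym E; case: (RF _ (hR i) _ j F2).
have /finite_seqP[r Rr] := Rfin.
have [f0 Ff0] : F !=set0.
  apply: contrapT => F0; apply: Ainf; apply: sub_finite_set Rfin => a Aa.
  by split=> // -[f Ff _]; apply: F0; exists f.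
(* Each element of [A] gets a sequence of [F] and an index. Indices below [size r] are reserved for
   the finite rest [R], the others are shifted by [size r]. *)
have /choice[e He] : forall a, exists p : (nat -> T) * nat, A a ->
    F p.1 /\ a = if (p.2 < size r)%N then nth a r p.2 else p.1 (p.2 - size r)%N.
  move=> a; have [Aa|] := pselect (A a); last by exists (f0, 0).
  have [[f Ff [i _ <-]]|Ra] := pselect ([set f i | f in F & i in [set: nat]] a).
    by exists (f, size r + i)%N => _ /=; rewrite ltnNge leq_addr addKn.
  have : a \in r by have : R a by []; rewrite Rr.
  by move=> ar; exists (f0, index a r) => _ /=; rewrite index_mem ar nth_index.
have eI a b : A a -> A b -> e a = e b -> a = b.
  move=> /He[_ Ea] /He[_ Eb] E; rewrite Ea Eb E.
  by case: ifP => // lt; exact: set_nth_default.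
(* The pair [(a, i)] goes to an entry of the sequence attached to [a]: disjointness recovers the
   sequence, and injectivity the coded pair. *)
pose f (p : T * nat) := (e p.1).1 (pickle ((e p.1).2, p.2)).
apply: (@card_le_inj _ _ _ _ f) => [[a i] [b j] [/= Aa _] [/= Ab _]|[a i] [/= Aa _]].
  rewrite /f /= => E; have [[Fa _] [Fb _]] := (He _ Aa, He _ Ab).
  have Eab := Fdisj _ _ Fa Fb _ _ E; move: E; rewrite Eab.
  move=> /((FA _ Fb).1)/(pcan_inj pickleK)[Eab2 ->]; congr pair; apply: eI => //.
  by rewrite [e a]surjective_pairing Eab Eab2 -surjective_pairing.
by apply: (FA _ (He _ Aa).1).2.
Qed.

Lemma mkseq_scons (T : Type) (g : T) w k :
  mkseq (scons g w) k.+1 = g :: mkseq w k.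
Proof. by rewrite /mkseq /= (iotaDl 1 0) -map_comp. Qed.

Section Cliques.
Variables (G : groupType) (X : set G).
Local Open Scope group_scope.

Definition clique (D : set G) (s : seq G) :=
  [/\ uniq s, forall a, a \in s -> X a &
      forall a b, a \in s -> b \in s -> a <> b -> D (a^-1 * b)].

Lemma clique_sub (D D' : set G) s s' : D `<=` D' -> uniq s' -> {subset s' <= s} ->
  clique D s -> clique D' s'.
Proof.
by move=> DD' us' ss' [_ sX sD]; split=> // [a /ss'/sX//|a b /ss' as_ /ss' bs ab];
  apply/DD'/sD.
Qed.

Lemma clique_cons D a s : (forall g, D g -> D g^-1) -> clique D s ->
  X a -> a \notin s -> (forall b, b \in s -> D (a^-1 * b)) -> clique D (a :: s).
Proof.
move=> Dsym [us sX sD] Xa nas aD; split; first by rewrite /= nas.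
  by move=> b; rewrite inE => /orP[/eqP->//|/sX].
move=> b c; rewrite !inE => /orP[/eqP->|bs] /orP[/eqP->|cs] // bc.
- exact: aD.
- by have := Dsym _ (aD _ bs); rewrite invgM invgK.
- exact: sD.
Qed.

(** Ramsey's theorem for two colours, which may overlap; symmetry of the sets makes the edges
    undirected. The bound at [a.+1], [b.+1] is [N1 + N2 + 1], from splitting the neighbours of the
    first element by colour. *)
Lemma clique_ramsey (D1 D2 : set G) :
  (forall g, D1 g -> D1 g^-1) -> (forall g, D2 g -> D2 g^-1) ->
  forall a b, exists N, forall s, clique (D1 `|` D2) s -> N <= size s ->
    (exists s', [/\ clique D1 s', {subset s' <= s} & size s' = a]) \/
    (exists s', [/\ clique D2 s', {subset s' <= s} & size s' = b]).
Proof.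
move=> sym1 sym2; have nilP D s : clique D [::] /\ {subset [::] <= s} by split=> //; split.
elim=> [b|a IHa]; first by exists 0 => s _ _; left; exists [::]; split=> //; apply: nilP.1.
elim=> [|b [N2 HN2]]; first by exists 0 => s _ _; right; exists [::]; split=> //; apply: nilP.1.
have [N1 HN1] := IHa b.+1; exists (N1 + N2).+1 => -[//|x t] ct; rewrite ltnS => tN.
pose p1 y := `[< D1 (x^-1 * y) >]; pose p2 y := `[< D2 (x^-1 * y) >].
have [/=/andP[xt ut] sX sD] := ct.
have sub p : clique (D1 `|` D2) (filter p t).
  apply: clique_sub ct => //; first exact: filter_uniq.
  by move=> y; rewrite mem_filter inE => /andP[_ ->]; rewrite orbT.
have tsize : size t <= size (filter p1 t) + size (filter p2 t).
  rewrite !size_filter -count_predUI (leq_trans _ (leq_addr _ _)) //.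
  rewrite -[leqLHS](count_predT) count_predT; apply/eq_leq/esym/eqP; rewrite -all_count.
  apply/allP => y yt; have xy : x <> y by move=> E; move: xt; rewrite E yt.
  apply/orP; have [] : (D1 `|` D2) (x^-1 * y) by apply: sD => //; rewrite inE ?eqxx // yt orbT.
    by left; apply/asboolP.
  by right; apply/asboolP.
have fsub p : {subset filter p t <= x :: t}.
  by move=> y; rewrite mem_filter inE => /andP[_ ->]; rewrite orbT.
have add D (p : pred G) s' : (forall g, D g -> D g^-1) -> (forall y, p y -> D (x^-1 * y)) ->
    clique D s' -> {subset s' <= filter p t} -> clique D (x :: s') /\ {subset x :: s' <= x :: t}.
  move=> Dsym pD cs' sub'; split.
    apply: clique_cons => //; first exact/sX/mem_head.
      by apply/negP => /sub'; rewrite mem_filter (negPf xt) andbF.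
    by move=> y /sub'; rewrite mem_filter => /andP[/pD].
  by move=> y; rewrite inE => /orP[/eqP->|/sub'/fsub//]; exact: mem_head.
have [N1t|N2t] : N1 <= size (filter p1 t) \/ N2 <= size (filter p2 t).
  case: (leqP N1 (size (filter p1 t))) => [|lt1]; [by left | right].
  rewrite leqNgt; apply/negP => lt2.
  by have := leq_trans tN tsize; rewrite leqNgt -addSn leq_add // ltnW.
- have [[s' [cs' ss' <-]]|[s' [cs' ss' <-]]] := HN1 _ (sub p1) N1t.
    left; exists (x :: s'); have [] // := add D1 p1 s' sym1 _ cs' ss'.
    by move=> y /asboolP.
  by right; exists s'; split=> // y /ss'/fsub.
- have [[s' [cs' ss' <-]]|[s' [cs' ss' <-]]] := HN2 _ (sub p2) N2t.
    by left; exists s'; split=> // y /ss'/fsub.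
  right; exists (x :: s'); have [] // := add D2 p2 s' sym2 _ cs' ss'.
  by move=> y /asboolP.
Qed.

End Cliques.

(** * Thin sets *)

Section Thin.
Variables (L : language) (M : structure L) (K : Type) (G : groupType) (n : nat).
Variable iota : G -> n.-tuple M.
Hypotheses (hM : monster K M) (hG : definable_group iota).
Variable X : set G.
Hypothesis hX : gset iota X.
Local Open Scope group_scope.

Definition symdef (D : set G) :=
  [/\ gset iota D, forall g, D g -> D g^-1 & ~ D 1].

Definition thin (D : set G) :=
  symdef D /\ exists N, forall s, clique X D s -> size s < N.

Lemma symdefI D1 D2 : symdef D1 -> symdef D2 -> symdef (D1 `&` D2).
Proof.
move=> [h1 s1 n1] [h2 s2 n2]; split; first exact: gd_and.
  by move=> g [/s1 ? /s2 ?].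
by move=> [].
Qed.

Lemma symdefU D1 D2 : symdef D1 -> symdef D2 -> symdef (D1 `|` D2).
Proof.
move=> [h1 s1 n1] [h2 s2 n2]; split; first exact: gd_or.
  by move=> g [/s1 ?|/s2 ?]; [left|right].
by move=> [].
Qed.

Lemma thin0 : thin set0.
Proof.
split; first by split=> //; apply: gd_ext (gd_not (gd_true iota)) => w; split=> // H; exact: H.
exists 2 => -[//|x [//|y s]] [/= /andP[xy _] _ H].
case: (H x y); rewrite ?inE ?eqxx ?orbT // => E.
by move: xy; rewrite E inE eqxx.
Qed.

Lemma thinU D1 D2 : thin D1 -> thin D2 -> thin (D1 `|` D2).
Proof.
move=> [d1 [N1 t1]] [d2 [N2 t2]]; split; first exact: symdefU.
have [[_ s1 _] [_ s2 _]] := (d1, d2).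
have [N HN] := @clique_ramsey _ X _ _ s1 s2 N1 N2.
exists N => s cs; rewrite ltnNge; apply/negP => /(HN _ cs)[][s' [cs' _ ss']].
  by have := t1 _ cs'; rewrite ss' ltnn.
by have := t2 _ cs'; rewrite ss' ltnn.
Qed.

Lemma gd_clique D k : symdef D -> gd iota (fun w => clique X D (mkseq w k)).
Proof.
move=> [hD _ D1].
have h1 := gd_lt k (fun i => gd_in hX (gterm_var i)).
have h2 : gd iota (fun w => forall i, i < k -> forall j, j < k ->
    i <> j -> D ((w i)^-1 * w j)).
  apply: gd_lt => i; apply: gd_lt => j; have [<-|/eqP ij] := eqVneq i j.
    by apply: gd_ext (gd_true iota) => w; split.
  apply: gd_ext (gd_in hD (gterm_mul hG (gterm_inv hG (gterm_var i)) (gterm_var j))) => w.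
  by split=> // H; exact: H.
apply: gd_ext (gd_and h1 h2) => w; split=> [[wX wD]|[uw wX wD]].
  split=> [|a /mapP[i]|a b /mapP[i + ->] /mapP[j + ->]].
  (* A repeated entry would put [1] in [D]. *)
  - apply/mkseq_uniqP => i j ik jk wij; apply: contrapT => ij.
    by apply: D1; have := wD i ik j jk ij; rewrite wij mulVg.
  - by rewrite mem_iota => /= ik ->; exact: wX.
  - by rewrite !mem_iota => /= ik jk wij; apply: wD => // ij; apply: wij; rewrite ij.
have mw i : i < k -> w i \in mkseq w k by move=> ik; apply: map_f; rewrite mem_iota.
split=> [i /mw/wX//|i ik j jk ij]; apply: wD; [exact: mw | exact: mw |].
by move=> wij; apply: ij; move/mkseq_uniqP: uw; apply.
Qed.

(** For [D] in [symdef], a fixed [N] and a fixed length of [c], this is a 0-definable relation of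
    the entries of [c]. In this form the existence of long cliques is fed to saturation. *)
Definition extends D N c := exists t, size t = N /\ clique X D (t ++ c).

Lemma gd_extends D N k : symdef D -> gd iota (fun w => extends D N (mkseq w k)).
Proof.
move=> sD; elim: N k => [|N IH] k.
  apply: gd_ext (gd_clique k sD) => w; split=> [H|[t [/size0nil->]]//].
  by exists [::].
apply: gd_ext (gd_ex hG (IH k.+1)) => w; split=> [[g [t [<-]]]|[t []]].
  by rewrite mkseq_scons -cat_rcons => ct; exists (rcons t g); rewrite size_rcons.
case/lastP: t => // t g; rewrite size_rcons => -[tN]; rewrite cat_rcons => ct.
by exists g, t; rewrite mkseq_scons.
Qed.

Lemma extends_le D D' N N' c c' : D `<=` D' -> N' <= N -> uniq c' ->
  {subset c' <= c} -> extends D N c -> extends D' N' c'.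
Proof.
move=> DD' NN' uc' cc' [t [tN ct]]; exists (take N' t); split.
  by rewrite size_takel ?tN.
have [utc _ _] := ct; apply: clique_sub ct => //; last first.
  move=> a; rewrite !mem_cat => /orP[/mem_take ->//|/cc' ->]; exact: orbT.
move: utc; rewrite !cat_uniq uc' => /and3P[ut /hasPn tc _].
rewrite take_uniq //= andbT; apply/hasPn => a /cc'/tc.
by apply: contra => /mem_take.
Qed.

Lemma extends_first D N c : extends D N.+1 c -> exists x, extends D N (x :: c).
Proof.
move=> [t []]; case/lastP: t => // t x; rewrite size_rcons => -[tN].
by rewrite cat_rcons => ct; exists x, t.
Qed.

(** * Thin sets around the points outside an invariant subgroup of bounded index *)

Section Key.
Variables (S : set G) (u : G).
Hypotheses (S_subgroup : subgroup S) (S_inv : Defs.invariant iota S).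
Hypotheses (S_bdd : bounded_index K (generated X) S) (Su : ~ S u).

Let T := [set D | symdef D /\ D u].

(** If [x] were in [S], by invariance and homogeneity it would have the type neither of [u] nor of
    [u^-1]. So some [E1] contains [u] but not [x], some [E2] contains [u^-1] but not [x], and their
    symmetrised combination [D] is in [T] and omits [x]. *)
Lemma types_outside x : (forall D, T D -> D x) -> ~ S x.
Proof.
move=> xT Sx; have [S1 _ SV] := S_subgroup.
have inv := (invariantP hG S).1 S_inv.
have [/(homogeneity hM hG)[s [sg [hs sgP sgu]]]|] :=
    pselect (forall E, gset iota E -> E u -> E x).
  by apply: Su; apply/(inv _ _ hs sgP); rewrite sgu.
have [/(homogeneity hM hG)[s [sg [hs sgP sgu]]]|] :=
    pselect (forall E, gset iota E -> E u^-1 -> E x).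
  by move=> _; apply: Su; rewrite -[u]invgK; apply: SV; apply/(inv _ _ hs sgP); rewrite sgu.
move=> /existsNP[E2] /not_implyP[hE2] /not_implyP[E2u E2x].
move=> /existsNP[E1] /not_implyP[hE1] /not_implyP[E1u E1x].
pose D := [set g | ((E1 g /\ E2 g^-1) \/ (E1 g^-1 /\ E2 g)) /\ g <> 1].
have /xT[[[//]|[_ //]] _] : T D.
split; last by split; [left | move=> u1; apply: Su; rewrite u1].
split=> [|g [Dg g1]|[]//].
  have hi E : gset iota E -> gd iota (fun w => E (w 0)^-1) := fun hE => gset_inv hG hE.
  apply: gd_and; last by apply/gd_not/(gd_eq hG (gterm_var 0) (gterm_one hG)).
  by apply: gd_or; apply: gd_and; [exact: hE1 | exact: hi | exact: hi | exact: hE2].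
split; last by move=> /(canRL (@invgK _)); rewrite invg1.
by rewrite invgK; case: Dg; [right | left]; tauto.
Qed.

(** A condition on finite parts, so stable under unions of chains, and strong enough to allow one
    more element: for every [D] in [T], each finite part lies in [D]-cliques of unlimited finite
    length. *)
Let coherent (C : set G) := forall c, uniq c -> (forall a, a \in c -> C a) ->
  forall D N, T D -> extends D N c.

(* The elements extending [C] coherently realize a finitely satisfiable partial
   type with parameters in [C], hence in the nonempty [C']. *)
Lemma coherent_extend (C C' : set G) : coherent C -> C `<=` C' -> C' !=set0 ->
  bounded K (coords iota C') -> T !=set0 ->
  exists2 x, ~ C x & coherent (C `|` [set x]).
Proof.
move=> cC CC' [c0 C'c0] bC' [D0 TD0].
pose B (p : seq G * set G * nat) := [set x | extends p.1.2 p.2 (x :: p.1.1)].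
pose I := [set p : seq G * set G * nat |
  [/\ uniq p.1.1, forall a, a \in p.1.1 -> C a & T p.1.2]].
have [||x xP] := saturation hM hG (F := B @` I) bC'.
- move=> _ [[[c D] N] [/= uc Cc [sD _]] <-].
  exists (fun w => extends D N (mkseq w (size c).+1)), (nth c0 c); split.
  + exact: gd_extends.
  + move=> i; case: (ltnP i (size c)) => ic; last by rewrite nth_default.
    by apply/CC'/Cc/mem_nth.
  + by apply/predeqP => x; rewrite /B /mkset /= mkseq_scons mkseq_nth.
- apply: fip_directed.
  + by exists (B ([::], D0, 0)); apply: imageP.
  + move=> _ [[[c D] N] [/= uc Cc TD] <-].
    by have [x] := extends_first (cC c uc Cc D N.+1 TD); exists x.
  + move=> _ _ [[[c1 D1] N1] [/= uc1 Cc1 [sD1 D1u]] <-]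
      [[[c2 D2] N2] [/= uc2 Cc2 [sD2 D2u]] <-].
    (* Cliques for the intersection are cliques for both sets, and the intersection still contains
       [u]. *)
    exists (B (undup (c1 ++ c2), D1 `&` D2, maxn N1 N2)).
      apply: imageP; split=> /=; first exact: undup_uniq.
        by move=> a; rewrite mem_undup mem_cat => /orP[/Cc1|/Cc2].
      by split; [exact: symdefI | split].
    move=> x; rewrite /B /= => ex.
    have [t [_ [+ _ _]]] := ex; rewrite cat_uniq => /and3P[_ _ /= /andP[xc _]].
    move: xc; rewrite mem_undup mem_cat => /norP[xc1 xc2].
    split; apply: extends_le ex.
    * by move=> g [].
    * exact: leq_maxl.
    * by rewrite /= xc1.
    * by move=> a; rewrite !inE mem_undup mem_cat => /orP[->//|->]; rewrite orbT.
    * by move=> g [].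
    * exact: leq_maxr.
    * by rewrite /= xc2.
    * by move=> a; rewrite !inE mem_undup mem_cat => /orP[->//|->]; rewrite !orbT.
have {}xP c D N : uniq c -> (forall a, a \in c -> C a) -> T D -> extends D N (x :: c).
  by move=> uc Cc TD; apply: (xP (B (c, D, N))); apply: imageP.
exists x => [Cx|c uc Cc D N TD].
  (* Applied to the list [[:: x]], the property would yield a clique in which [x] is repeated. *)
  have [||t [_ [+ _ _]]] := xP [:: x] D0 0 _ _ TD0 => //.
    by move=> a; rewrite inE => /eqP->.
  by rewrite cat_uniq /= inE eqxx !andbF.
have Cc' a : a \in rem x c -> C a.
  by rewrite mem_rem_uniq // inE => /andP[/eqP ax] /Cc[|/ax].
apply: extends_le (xP _ D N (rem_uniq x uc) Cc' TD) => //.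
by move=> a ac; rewrite inE mem_rem_uniq // inE ac andbT orbN.
Qed.

(** If [u] lay in no thin set, the empty set would be coherent. A maximal coherent [C] cannot have
    boundedly many coordinates, by [coherent_extend], and its elements lie in distinct cosets of
    [S], against bounded index. *)
Lemma thin_outside : X `<=` generated X -> exists2 D, thin D & D u.
Proof.
move=> XH; apply: contrapT => noD.
have T0 : T !=set0.
  exists [set g | g <> 1]; split; last by move=> /= u1; apply: Su; rewrite u1; case: S_subgroup.
  split=> [|g /= g1 /(canRL (@invgK _))|]; last exact.
    by apply/gd_not/(gd_eq hG (gterm_var 0) (gterm_one hG)).
  by rewrite invg1.
have ext0 D N : T D -> extends D N [::].
  move=> [sD Du]; have [s cs Ns] : exists2 s, clique X D s & N <= size s.
    apply: contrapT => noS; apply: noD; exists D => //; split=> //; exists N => s cs.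
    by rewrite ltnNge; apply/negP => Ns; apply: noS; exists s.
  apply: (@extends_le D D (size s) N [::] [::]) => //.
  by exists s; rewrite cats0.
have [Fs FsP Fstot|C [cC Cmax]] := @Zorn_bigcup _ coherent.
  move=> c uc Cc D N TD; have [->|[A FA cA]] := seq_sub_chain Fstot Cc; first exact: ext0.
  exact: (FsP _ FA).
have nobdd C' : C `<=` C' -> C' !=set0 -> ~ bounded K (coords iota C').
  move=> CC' C'0 bC'; have [x Cx cCx] := coherent_extend cC CC' C'0 bC' T0.
  apply: (Cmax _ _ cCx); split=> [y Cy|/(_ x (or_intror erefl))//]; by left.
have Cinf : infinite_set C.
  (* Adding [1] makes the parameter set nonempty when [C] is empty. *)
  move=> Cfin; apply: (nobdd (C `|` [set 1])); first by move=> y; left.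
    by exists 1; right.
  apply: (countable_bounded hM); apply: coords_countable; apply: finite_set_countable.
  by rewrite finite_setU.
have KC : ([set: K] #<= coords iota C)%card.
  apply: contrapT; apply: (nobdd C) => //.
  exact: infinite_setN0.
apply: S_bdd; apply: (card_le_trans KC).
(* Each element has only [n] coordinates, a factor which the infinite set [C] absorbs. *)
have cC1 : (coords iota C #<= C `*` [set: 'I_n])%card.
  apply: card_le_trans (card_image_le (fun p => tnth (iota p.1) p.2) _).
  by apply: subset_card_le => _ [c [i [Cc ->]]]; exists (c, i).
apply: (card_le_trans cC1).
have cC2 : (C `*` [set: 'I_n] #<= C `*` [set: nat])%card.
  apply: (@card_le_inj _ _ _ _ (fun p => (p.1, nat_of_ord p.2))).
    by move=> [a i] [b j] _ _ /= [-> /val_inj ->].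
  by move=> [a i] [].
apply: (card_le_trans (card_le_trans cC2 (infinite_card_setXnat Cinf))).
apply: (@card_le_inj _ _ _ _ (fun c => translate c S)) => [a b Ca Cb E|c Cc]; last first.
  have [D0 TD0] := T0.
  exists c => //; apply: XH; have [||t [_ [_ + _]]] := cC [:: c] _ _ D0 0 TD0 => //.
    by move=> y; rewrite inE => /eqP->.
  by apply; rewrite mem_cat mem_head orbT.
apply: contrapT => ab; have [S1 _ _] := S_subgroup.
have : translate b S a by rewrite -E; exists 1 => //; rewrite mulg1.
move=> [s Ss bs]; have {}bs : s = b^-1 * a by rewrite -bs mulKg.
suff : ~ S s by [].
apply: types_outside => D TD; rewrite bs.
have [||t [_ [_ _ H]]] := cC [:: a; b] _ _ D 0 TD.
- by rewrite /= inE andbT; apply/eqP.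
- by move=> y; rewrite !inE => /orP[]/eqP->.
- by apply: H; rewrite ?mem_cat ?inE ?eqxx ?orbT //; apply/nesym.
Qed.

End Key.
End Thin.

(** * The smallest invariant subgroup of bounded index *)

Section Powers.
Variable G : groupType.
Implicit Types (A B Y S : set G).
Local Open Scope group_scope.

Lemma symmetric_inv Y g : symmetric_set Y -> Y g -> Y g^-1.
Proof. by move=> [YE _] Yg; rewrite -YE; exists g. Qed.

Lemma set_pow_mono A B m : A `<=` B -> set_pow A m `<=` set_pow B m.
Proof.
move=> AB; elim: m => [//|m IH] _ [x /AB Bx [y /IH By <-]].
by exists x => //; exists y.
Qed.

Lemma set_powD Y a b x y :
  set_pow Y a x -> set_pow Y b y -> set_pow Y (a + b) (x * y).
Proof.
elim: a x => [|a IH] x; first by move=> -> yb; rewrite mul1g.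
move=> [z Yz [x' x'a <-]] yb; exists z => //.
by exists (x' * y); [exact: IH | rewrite mulgA].
Qed.

Lemma set_pow1 Y x : Y x -> set_pow Y 1%N x.
Proof. by move=> Yx; exists x => //; exists 1 => //; rewrite mulg1. Qed.

Lemma set_pow_le Y a b : Y 1 -> a <= b -> set_pow Y a `<=` set_pow Y b.
Proof.
move=> Y1 ab; rewrite -(subnKC ab) => x xa; rewrite -[x]mulg1.
apply: set_powD => //; elim: (b - a)%N => [//|k IH].
by exists 1 => //; exists 1 => //; rewrite mulg1.
Qed.

Lemma set_powV Y m x : symmetric_set Y -> set_pow Y m x -> set_pow Y m x^-1.
Proof.
move=> Ysym; elim: m x => [_ ->|m IH _ [y Yy [z /IH zm <-]]].
  by rewrite invg1.
rewrite invgM -addn1; apply: set_powD => //.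
by apply: set_pow1; exact: symmetric_inv.
Qed.

Lemma generated_subgroup A : subgroup (generated A).
Proof.
split=> [B [[B1 _ _] _]//|x y xA yA B BP|x xA B BP].
  by have [[_ BM _] _] := BP; apply: BM; [exact: xA | exact: yA].
by have [[_ _ BV] _] := BP; apply: BV; exact: xA.
Qed.

Lemma sub_generated A : A `<=` generated A.
Proof. by move=> x Ax B [_]; exact. Qed.

Lemma generated_min A S : subgroup S -> A `<=` S -> generated A `<=` S.
Proof. by move=> HS AS x; apply; split. Qed.

Lemma set_pow_sub A S m : subgroup S -> A `<=` S -> set_pow A m `<=` S.
Proof.
move=> [S1 SM _] AS; elim: m => [_ ->//|m IH _ [x /AS Sx [y /IH Sy <-]]].
exact: SM.
Qed.

Lemma generated_pow A : symmetric_set A ->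
  forall g, generated A g -> exists m, set_pow A m g.
Proof.
move=> Asym; apply: (@generated_min A [set g | exists m, set_pow A m g]).
  split; first by exists 0.
    by move=> x y [a xa] [b yb]; exists (a + b)%N; exact: set_powD.
  by move=> x [a xa]; exists a; exact: set_powV.
by move=> x Ax; exists 1%N; exact: set_pow1.
Qed.

Definition covers (s : seq G) A Y := forall g, A g -> exists2 f, f \in s & Y (f^-1 * g).

Lemma covers_trans s t A B Y : covers s A B -> covers t B Y ->
  covers [seq f * g | f <- s, g <- t] A Y.
Proof.
move=> cs ct g /cs[f fs /ct[h ht]]; rewrite mulgA -invgM => Yg.
by exists (f * h) => //; apply: allpairs_f.
Qed.

Lemma translate_covers (F : set G) A Y : finite_set F ->
  A `<=` \bigcup_(g in F) translate g Y -> exists s, covers s A Y.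
Proof.
move=> /finite_seqP[s ->] AY; exists s => g /AY[f fs [y Yy <-]].
by exists f => //; rewrite mulKg.
Qed.

Lemma approximate_covers A m : approximate_subgroup A ->
  exists s, covers s (set_pow A m) A.
Proof.
move=> [Asym [F /translate_covers tF /tF[t ct]]]; have A1 := Asym.2.
elim: m => [|m [s cs]]; first by exists [:: 1] => _ ->; exists 1; rewrite ?inE // mulVg.
exists [seq f * g | f <- s, g <- t]; apply: covers_trans ct => g.
rewrite -addn1 => gm.
(* The last factor is split off: once the other [m] factors are covered by translates of [A], what
   remains lies in the square of [A], which [t] covers. *)
have [h [a [hm Aa <-]]] : exists h a, [/\ set_pow A m h, A a & h * a = g].
  elim: m g gm {s cs} => [|m IH] g; last first.
    move=> [x Ax [y /IH[h [a [hm Aa <-]]] <-]].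
    by exists (x * h), a; split=> //; [exists x => //; exists h | rewrite mulgA].
  by move=> [x Ax [_ -> <-]]; exists 1, x; rewrite mul1g mulg1.
have [f fs Af] := cs _ hm; exists f => //.
by exists (f^-1 * h) => //; exists a => //; rewrite mulgA.
Qed.

Lemma translate_eq S a b : subgroup S -> S (a^-1 * b) -> translate a S = translate b S.
Proof.
move=> [S1 SM SV] Sab; apply/seteqP; split=> _ [x Sx <-].
  exists ((a^-1 * b)^-1 * x); first by apply: SM => //; exact: SV.
  by rewrite invgM invgK !mulgA mulgV mul1g.
by exists (a^-1 * b * x); [exact: SM | rewrite !mulgA mulgV mul1g].
Qed.

End Powers.

(** * Functions from formulas to numbers as sets of formulas *)

Section Coding.
Variable L : language.

Fixpoint tower n (i : nat) : formula L n :=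
  if i is j.+1 then FImp (FFalse L n) (tower n j) else FFalse L n.

Fixpoint depth n (phi : formula L n) : nat :=
  match phi with FImp _ _ psi => (depth psi).+1 | _ => 0 end.

Definition premise n (phi : formula L n) : option (formula L n) :=
  match phi with FImp _ psi _ => Some psi | _ => None end.

Lemma towerK n : cancel (tower n) (@depth n).
Proof. by elim=> //= i ->. Qed.

(** Turns a formula and a number into one formula, so that the graph of a function from formulas to
    numbers becomes a set of formulas, to which [monster_large] applies. *)
Definition code n (phi : formula L n) (i : nat) : {k & formula L k} :=
  existT (formula L) n (FImp phi (tower n i)).

Lemma code_inj n (phi psi : formula L n) i j :
  code phi i = code psi j -> phi = psi /\ i = j.
Proof.
move=> ij; have E := Eqdep_dec.inj_pair2_eq_dec _ (@eq_comparable nat) _ _ _ _ ij.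
split; first by have [] := congr1 (@premise n) E.
by have [] := congr1 (@depth n) E; rewrite !towerK.
Qed.

End Coding.

(** * The sets [core m] and the component H^000 *)

Section Components.
Variables (L : language) (M : structure L) (K : Type) (G : groupType) (n : nat).
Variable iota : G -> n.-tuple M.
Hypotheses (hM : monster K M) (hG : definable_group iota).
Variable X : set G.
Hypotheses (hXdef : gdefinable iota X) (hX : approximate_subgroup X).
Local Open Scope group_scope.

Let X_gset : gset iota X. Proof. exact/gset_gdefinable. Qed.
Let X_sym : symmetric_set X. Proof. by case: hX. Qed.
Let X1 : X 1. Proof. by case: X_sym. Qed.

Definition cothin (D : set G) := set_pow X 2 `&` ~` D.

Lemma gset_cothin D : thin iota X D -> gset iota (cothin D).
Proof. by move=> [[hD _ _] _]; apply: gd_and (gset_pow hG 2 X_gset) (gd_not hD). Qed.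

(* The elements of a clique of maximal length translate [cothin D] onto [X]. *)
Lemma cothin_generic D : thin iota X D -> generic_symmetric iota X (cothin D).
Proof.
move=> tD; have [[hD Dsym D1] [N HN]] := tD; split.
- move=> g [gX _]; apply: set_pow_sub gX; first exact: generated_subgroup.
  exact: sub_generated.
- exact/gset_gdefinable/gset_cothin.
- pose p k := `[< exists2 s, clique X D s & size s = k >].
  have p0 : exists k, p k by exists 0; apply/asboolP; exists [::].
  have pN k : p k -> k <= N by move=> /asboolP[s /HN/ltnW + <-].
  case: (ex_maxnP p0 pN) => k /asboolP[s cs sk] kmax.
  have [us sX _] := cs.
  exists [set` s]; split; first exact: finite_seq.
    by move=> f /= /sX; exact: sub_generated.
  move=> x Xx; apply: contrapT => nx.
  have xD a : a \in s -> D (a^-1 * x).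
    move=> as_; apply: contrapT => nD; apply: nx; exists a => //.
    exists (a^-1 * x); last by rewrite mulVKg.
    split=> //; apply: (@set_powD _ _ 1%N 1%N); apply: set_pow1 => //.
    by apply: symmetric_inv => //; exact: sX.
  have : p k.+1.
    apply/asboolP; exists (x :: s); last by rewrite /= sk.
    apply: clique_cons => //; last first.
      by move=> b /xD/Dsym; rewrite invgM invgK.
    by apply/negP => /xD; rewrite mulVg.
  by move=> /kmax; rewrite ltnn.
- split; last by split=> //; apply: (@set_pow_le _ _ 0).
  apply/seteqP; split=> [_ [g [gX nD] <-]|g [gX nD]].
    by split; [exact: set_powV | move=> /Dsym; rewrite invgK].
  exists g^-1; last by rewrite invgK.
  by split; [exact: set_powV | move=> /Dsym; rewrite invgK].
Qed.

Definition core m : set G :=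
  [set g | forall Y, generic_symmetric iota X Y -> set_pow Y m g].

Lemma core_gtype_definable m : gtype_definable iota (core m).
Proof.
apply/(gtype_definableP hG).
exists [set B | exists2 Y, generic_symmetric iota X Y & B = set_pow Y m].
split=> [B [Y [_ /(gset_gdefinable hG) hY _ _] ->]|]; first exact: gset_pow.
apply/predeqP => g; split=> [H _ [Y hY ->]|H Y hY]; first exact: H.
by apply: H; exists Y.
Qed.

Lemma self_generic : generic_symmetric iota X X.
Proof.
split=> //; first exact: sub_generated.
exists [set 1]; split; first exact: finite_set1.
  by move=> _ ->; have [] := generated_subgroup X.
by move=> x Xx; exists 1 => //; exists x => //; rewrite mul1g.
Qed.

Lemma core_sub_generated m : core m `<=` generated X.
Proof.
move=> g /(_ _ self_generic); apply: set_pow_sub; first exact: generated_subgroup.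
exact: sub_generated.
Qed.

(** A point lying in [cothin D] for all thin [D] is in [S], by [thin_outside]. For the powers, by
    induction on [m], compactness finds one first factor that works for all thin [D] at once. *)
Lemma core_sub S m : subgroup S -> Defs.invariant iota S ->
  bounded_index K (generated X) S -> core m `<=` S.
Proof.
move=> S_subgroup S_inv S_bdd; have [S1 SM _] := S_subgroup.
have avoid g : (forall D, thin iota X D -> cothin D g) -> S g.
  move=> H; apply: contrapT => Sg.
  have [D tD Dg] := thin_outside hM hG X_gset S_subgroup S_inv S_bdd Sg (@sub_generated _ X).
  by have [_] := H _ tD.
suff H : forall g, (forall D, thin iota X D -> set_pow (cothin D) m g) -> S g.
  by move=> g gm; apply: H => D /cothin_generic; exact: gm.
elim: m => [|m IH] g gm; first by have -> := gm _ (thin0 iota X).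
(* The possible first factors of [g]. This set decreases as [D] grows and thin sets are closed under
   union, so the family is directed. *)
pose B D := [set y | cothin D y /\ set_pow (cothin D) m (y^-1 * g)].
have Bmono D D' : D `<=` D' -> B D' `<=` B D.
  move=> DD'; have cDD' : cothin D' `<=` cothin D.
    by move=> y [yX nD']; split=> // /DD'.
  by move=> y [/cDD' yD]; move/(set_pow_mono cDD').
have [|||y yP] := saturation hM hG (C := [set g]) (F := B @` thin iota X) .
- apply: (countable_bounded hM); apply: coords_countable; exact: countable1.
- move=> _ [D tD <-].
  exists (fun w => cothin D (w 0) /\ set_pow (cothin D) m ((w 0)^-1 * w 1%N)), (fun=> g).
  split=> //; have hD := gset_cothin tD.
  apply: gd_and => //; apply: gd_in; first exact: gset_pow.
  by apply: (gterm_mul hG); [apply: (gterm_inv hG)|]; exact: gterm_var.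
- apply: fip_directed.
  + by exists (B set0); apply: imageP; exact: thin0.
  + move=> _ [D /gm[y yD [z zm yzg]] <-]; exists y; split=> //.
    by rewrite -yzg mulKg.
  + move=> _ _ [D1 t1 <-] [D2 t2 <-]; exists (B (D1 `|` D2)).
      by apply: imageP; apply: thinU.
    by move=> y yB; split; apply: Bmono yB => d; [left | right].
have {}yP D : thin iota X D -> B D y by move=> tD; apply: yP; exact: imageP.
rewrite -[g](mulVKg y); apply: SM.
  by apply: avoid => D /yP[].
by apply: IH => D /yP[].
Qed.

Lemma core2_invariant : Defs.invariant iota (generated (core 2)).
Proof.
apply/(invariantP hG) => s sg hs sgP g.
have sgM := lifts_mul hG hs sgP.
have coreE h : core 2 (sg h) <-> core 2 h.
  apply: (invariantP hG (core 2)).1 hs sgP h.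
  apply: gtype_definable_invariant => //; exact: core_gtype_definable.
have sg1 : sg 1 = 1.
  by apply: (@mulgI _ (sg 1)); rewrite -sgM !mulg1.
have sgV x : sg x^-1 = (sg x)^-1.
  by apply: (@mulgI _ (sg x)); rewrite -sgM !mulgV.
have [Q1 QM QV] := generated_subgroup (core 2).
split; last first.
  apply: (@generated_min _ _ [set h | generated (core 2) (sg h)]).
    split=> [|x y|x] /=; rewrite ?sg1 ?sgM ?sgV //; [exact: QM | exact: QV].
  by move=> x /coreE; exact: sub_generated.
(* For the converse, the image under [sg] of the generated subgroup is a subgroup that contains
   [core 2], by surjectivity; [sg'] is [sg], as both lift [s]. *)
have [sg' sg'P sgS] := aut_lifts hG hs.
have sgE x : sg x = sg' x by have [+ _ _] := hG; apply; rewrite sgP sg'P.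
have sgI : injective sg.
  move=> x y sxy; have [+ _ _] := hG; apply.
  apply: eq_from_tnth => i; apply: (bij_inj (aut_bij hs)).
  by have /(congr1 (fun t => tnth (iota t) i)) := sxy; rewrite !sgP !tnth_map.
suff H : generated (core 2) `<=` sg @` generated (core 2).
  by move=> /H[h Qh /sgI <-].
apply: generated_min => [|y].
  split; first by exists 1.
    by move=> _ _ [x Qx <-] [y Qy <-]; exists (x * y); rewrite ?sgM //; exact: QM.
  by move=> _ [x Qx <-]; exists x^-1; rewrite ?sgV //; exact: QV.
have [x <-] := sgS y; rewrite -sgE => /coreE cx.
by exists x => //; exact: sub_generated.
Qed.

(** The generated group is the union of the powers of [X], each covered by finitely many translates
    of [X], hence of [Y]. The index codes an exponent and a position in the corresponding list. *)
Lemma generic_enum Y : generic X Y ->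
  exists t : nat -> G, forall h, generated X h -> exists i, Y ((t i)^-1 * h).
Proof.
move=> [F [Ffin _ /(translate_covers Ffin)[r cr]]].
have /choice[s Hs] : forall m, exists s, covers s (set_pow X m) Y.
  move=> m; have [s cs] := approximate_covers m hX.
  by exists [seq f * g | f <- s, g <- r]; exact: covers_trans cs cr.
exists (fun i => if unpickle i is Some (m, j) then nth 1 (s m) j else 1) => h.
move=> /(generated_pow X_sym)[m /Hs[f fs Yf]].
by exists (pickle (m, index f (s m))); rewrite pickleK nth_index.
Qed.

(* A coset of [generated (core 2)] is determined by the family, indexed by the
   0-definable generic symmetric sets, of the translates containing a given
   representative; this bounds the index by 2 ^ (|L| + aleph_0). *)
Lemma core2_bounded_index :
  bounded_index K (generated X) (generated (core 2)).
Proof.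
pose Yf (phi : formula L n) := [set g | sat phi (iota g)].
pose gen phi := generic_symmetric iota X (Yf phi).
have /choice[t Ht] : forall phi, exists t : nat -> G, gen phi ->
    forall h, generated X h -> exists i, Yf phi ((t i)^-1 * h).
  move=> phi; have [[_ _ /generic_enum[t Ht] _]|ng] := pselect (gen phi).
    by exists t.
  by exists (fun=> 1).
have /choice[idx Hidx] : forall p : formula L n * G, exists i, gen p.1 ->
    generated X p.2 -> Yf p.1 ((t p.1 i)^-1 * p.2).
  move=> [phi h] /=; have [[gp Xh]|H] := pselect (gen phi /\ generated X h).
    by have [i Hi] := Ht _ gp _ Xh; exists i.
  by exists 0 => gp Xh; case: H.
pose c h := [set code phi (idx (phi, h)) | phi in gen].
have cE h h' : generated X h -> generated X h' -> c h = c h' -> core 2 (h^-1 * h').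
  move=> Xh Xh' E Y gY; have [XY /(gset_gdefinable hG) hY _ Ysym] := gY.
  have [phi YE] : exists phi, Y = Yf phi.
    have [phi E'] := (gset_gdefinable hG Y).1 hY; exists phi.
    apply/predeqP => g; rewrite /Yf /mkset.
    have -> : sat phi (iota g) = (iota @` Y) (iota g) by rewrite E'.
    by have [iI _ _] := hG; split=> [|[y Yy /iI <-]]//; exact: imageP.
  have gp : gen phi by rewrite /gen -YE.
  have : c h' (code phi (idx (phi, h))) by rewrite -E; exists phi.
  move=> [psi _ /code_inj[-> Ei]].
  (* Both [h] and [h'] lie in the same translate of [Y], whence [h^-1 * h'] is in the square of [Y]:
     this is the origin of the exponent 2. *)
  have Yh := Hidx (phi, h) gp Xh; have Yh' := Hidx (phi, h') gp Xh'.
  rewrite /= Ei in Yh'; rewrite /= -YE in Yh Yh'.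
  have -> : h^-1 * h' = ((t phi (idx (phi, h)))^-1 * h)^-1 * ((t phi (idx (phi, h)))^-1 * h').
    by rewrite invgM invgK -!mulgA mulVKg.
  apply: (@set_powD _ _ 1%N 1%N); apply: set_pow1 => //.
  exact: symmetric_inv.
set Q := generated (core 2) in cE *.
have /choice[rep Hrep] : forall A, exists h, (exists2 h', generated X h' & translate h' Q = A) ->
    generated X h /\ translate h Q = A.
  move=> A; have [[h Xh hA]|H] := pselect (exists2 h', generated X h' & translate h' Q = A).
    by exists h.
  by exists 1 => /H.
move=> KQ; apply: (monster_large hM); apply: (card_le_trans KQ).
apply: (@card_le_inj _ _ _ _ (fun A => c (rep A))) => // A B /Hrep[XA EA] /Hrep[XB EB] cAB.
rewrite -EA -EB; apply: translate_eq; first exact: generated_subgroup.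
by apply: sub_generated; exact: cE.
Qed.

Lemma generated_core2_H000 : is_H000 iota K (generated X) (generated (core 2)).
Proof.
split.
  split; [exact: generated_subgroup | | exact: core2_invariant | exact: core2_bounded_index].
  apply: generated_min; [exact: generated_subgroup | exact: core_sub_generated].
move=> S [S_subgroup _ S_inv S_bdd].
by apply: generated_min => //; exact: core_sub.
Qed.

End Components.

(** * Groups covered by countably many type-definable sets *)

Section CompactCovering.
Variables (G : groupType) (S Gam : set G) (Bs : set (set G)) (P : nat -> set G).
Local Open Scope group_scope.
Hypotheses (S_subgroup : subgroup S) (Gam_subgroup : subgroup Gam) (GamS : Gam `<=` S).
Hypotheses (BsT : Bs setT) (BsC : forall B, Bs B -> Bs (~` B))
  (BsI : forall A B, Bs A -> Bs B -> Bs (A `&` B))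
  (BsM : forall c B, Gam c -> Bs B -> Bs [set x | B (c * x)]).

(** The members of [Bs] play the part of clopen sets and a family of them stands for the closed
    subset of [S] that it cuts out; [meets] is the finite intersection property on [S]. *)
Let meets (F : set (set G)) := forall s : seq (set G), (forall B, B \in s -> F B) ->
  exists2 x, S x & forall B, B \in s -> B x.

Hypothesis S_compact : forall F, F `<=` Bs -> meets F ->
  exists2 x, S x & forall B, F B -> B x.
Hypotheses (PM : forall a b x y, P a x -> P b y -> P (a + b)%N (x * y))
  (PV : forall a x, P a x -> P a x^-1)
  (P_le : forall a b, a <= b -> P a `<=` P b)
  (P_closed : forall m x, ~ P m x -> exists B, [/\ Bs B, P m `<=` B & ~ B x])
  (P_cover : forall x, S x -> exists m, P m x).

(* Newelski's argument: let [Z] be a minimal closed [Gam]-invariant subset of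
   the compact set [S].  By Baire, some [P m] contains a nonempty relatively open
   subset of [Z]; by minimality finitely many translates of it cover [Z], so [Z]
   is contained in some [P N], and [Gam] in [Z Z^-1]. *)
Lemma compact_covering : exists m, Gam `<=` P m.
Proof.
have [S1 SM SV] := S_subgroup; have [G1 GM GV] := Gam_subgroup.
(* A maximal family in [Q] cuts out a minimal closed [Gam]-invariant set. *)
pose Q (F : set (set G)) := [/\ F `<=` Bs,
  forall c B, Gam c -> F B -> F [set x | B (c * x)] & meets F].
have [Fs FsQ Fstot|F [[FB Finv Fmeets] Fmax]] := @Zorn_bigcup _ Q.
  split=> [B [F FsF FB]|c B Gc [F FsF FB]|s sF].
  - by have [H _ _] := FsQ _ FsF; exact: H.
  - by exists F => //; have [_ H _] := FsQ _ FsF; exact: H.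
  - have [->|[F FsF sF']] := seq_sub_chain Fstot sF; first by exists 1.
    by have [_ _ H] := FsQ _ FsF; exact: H.
pose Z := [set x | S x /\ forall B, F B -> B x].
have Zinv c z : Gam c -> Z z -> Z (c * z).
  move=> Gc [Sz zF]; split; first by apply: SM => //; exact: GamS.
  by move=> B FBB; exact: (zF _ (Finv _ _ Gc FBB)).
(* Otherwise the complements of all the translates of [U] could be added to [F], against maximality:
   the complement of [U] itself is not in [F], because of [z0]. *)
have syndetic U : Bs U -> (exists2 z, Z z & U z) -> exists r : seq G,
    (forall c, c \in r -> Gam c) /\ forall z, Z z -> exists2 c, c \in r & U (c * z).
  move=> BU [z0 Zz0 Uz0]; apply: contrapT => nr.
  pose F' := F `|` [set [set x | ~ U (c * x)] | c in Gam].
  have FF' : F `<=` F' by left.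
  apply: (Fmax F').
    split=> // F'F; have : F [set x | ~ U (1 * x)] by apply: F'F; right; exists 1.
    by move=> /(Zz0.2 _); rewrite /= mul1g.
  split.
  - move=> B [/FB//|[c Gc <-]]; exact: (BsC (BsM Gc BU)).
  - move=> c B Gc [FBB|[d Gd <-]]; first by left; exact: Finv.
    right; exists (d * c); first exact: GM.
    by apply/predeqP => x /=; rewrite mulgA.
  - move=> s sF'.
    have [r [rG rs]] : exists r : seq G, (forall c, c \in r -> Gam c) /\
        forall B, B \in s -> F B \/ exists2 c, c \in r & B = [set x | ~ U (c * x)].
      elim: s sF' => [|B s IH] sF'; first by exists [::].
      have [|r [rG rs]] := IH; first by move=> A As; apply: sF'; rewrite inE As orbT.
      have [FBB|[c Gc EB]] := sF' B (mem_head _ _).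
        by exists r; split=> // A; rewrite inE => /orP[/eqP->|/rs//]; left.
      exists (c :: r); split=> [d|A]; rewrite inE => /orP[/eqP->|].
      + by [].
      + exact: rG.
      + by right; exists c => //; exact: mem_head.
      + by move=> /rs[|[d dr ->]]; [left | right; exists d => //; rewrite inE dr orbT].
    apply: contrapT => nz; apply: nr; exists r; split=> // z Zz.
    apply: contrapT => nc; apply: nz; exists z; first by case: Zz.
    move=> B /rs[/Zz.2//|[c cr ->]] /= Uc.
    by apply: nc; exists c.
have [m [U [BU [z0 Zz0 Uz0] UP]]] : exists m U,
    [/\ Bs U, exists2 z, Z z & U z & forall z, Z z -> U z -> P m z].
  apply: contrapT => nU.
  (* The Baire argument: [next] shrinks a set that meets [Z] to one that still meets [Z] but avoids
     [P m]. Iterating, compactness gives a point of [S] outside every [P m]. *)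
  have /choice[next Hnext] : forall p : nat * set G, exists U',
      Bs p.2 -> (exists2 z, Z z & p.2 z) ->
      [/\ Bs U', exists2 z, Z z & U' z, U' `<=` p.2 & forall z, U' z -> ~ P p.1 z].
    move=> [m U] /=; have [[BU UZ]|H] := pselect (Bs U /\ exists2 z, Z z & U z); last first.
      by exists set0 => BU UZ; case: H.
    have [z [Zz Uz nPz]] : exists z, [/\ Z z, U z & ~ P m z].
      apply: contrapT => nz; apply: nU; exists m, U; split=> // z Zz Uz.
      by apply: contrapT => nPz; apply: nz; exists z.
    have [B [BB PB nBz]] := P_closed nPz.
    exists (U `&` ~` B) => _ _; split.
    - by apply: BsI => //; exact: BsC.
    - by exists z.
    - by move=> x [].
    - by move=> x [_ nBx] /PB.
  pose V := fix V k := if k is k'.+1 then next (k', V k') else setT.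
  have VP k : Bs (V k) /\ exists2 z, Z z & V k z.
    elim: k => [|k [BV VZ]] /=.
      by split=> //; have [z Sz zF] := S_compact FB Fmeets; exists z.
    by have [] := Hnext (k, V k) BV VZ.
  have VS k : V k.+1 `<=` V k /\ forall z, V k.+1 z -> ~ P k z.
    by have [BV VZ] := VP k; have [] := Hnext (k, V k) BV VZ.
  have V_le j k : j <= k -> V k `<=` V j.
    move=> /subnKC <-; elim: (k - j)%N => [|i IH]; first by rewrite addn0.
    by rewrite addnS => x /(VS _).1/IH.
  have [||x Sx xF] := S_compact (F := F `|` range V).
  - by move=> B [/FB//|[k _ <-]]; exact: (VP k).1.
  - move=> s sF.
    have [N HN] : exists N, forall B, B \in s -> F B \/ V N `<=` B.
      elim: s sF => [|B s IH] sF; first by exists 0.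
      have [|N HN] := IH; first by move=> A As; apply: sF; rewrite inE As orbT.
      have [FBB|[k _ EB]] := sF B (mem_head _ _).
        by exists N => A; rewrite inE => /orP[/eqP->|/HN//]; left.
      exists (maxn N k) => A; rewrite inE => /orP[/eqP->|/HN[]]; [|by left|].
        by right; rewrite -EB; exact/V_le/leq_maxr.
      by move=> NA; right; apply: subset_trans NA; exact/V_le/leq_maxl.
    have [_ [z [Sz zF] Vz]] := VP N; exists z => // B /HN[/zF//|]; exact.
  - have [m Pm] := P_cover Sx; apply: (VS m).2 Pm; apply: xF; right.
    by exists m.+1.
have [|r [rG rZ]] := syndetic _ BU; first by exists z0.
have [N HN] : exists N, forall c, c \in r -> P N c.
  elim: r rG {rZ} => [|c r IH] rG; first by exists 0.
  have [|N HN] := IH; first by move=> d dr; apply: rG; rewrite inE dr orbT.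
  have [k Pk] := P_cover (GamS (rG c (mem_head _ _))).
  exists (maxn N k) => d; rewrite inE => /orP[/eqP->|/HN].
    by apply: P_le Pk; exact: leq_maxr.
  by apply: P_le; exact: leq_maxl.
have ZP z : Z z -> P (N + m)%N z.
  move=> Zz; have [c cr Uc] := rZ _ Zz.
  rewrite -[z](mulKg c); apply: PM; first exact/PV/HN.
  by apply: UP => //; apply: Zinv => //; exact: rG.
exists (N + m + (N + m))%N => c Gc.
rewrite -[c](mulgK z0); apply: PM; first exact/ZP/Zinv.
exact/PV/ZP.
Qed.

End CompactCovering.

(** * Type-definable subgroups of the group generated by [core 2] *)

Section Newelski.
Variables (L : language) (M : structure L) (K : Type) (G : groupType) (n : nat).
Variable iota : G -> n.-tuple M.
Hypotheses (hM : monster K M) (hG : definable_group iota).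
Variable X : set G.
Local Open Scope group_scope.

Lemma cdef_gset (C B : set G) c : C c -> gset iota B -> cdef iota C B.
Proof. by move=> Cc hB; exists (fun w => B (w 0)), (fun=> c). Qed.

Lemma cdefC (C B : set G) : cdef iota C B -> cdef iota C (~` B).
Proof.
by move=> [P [w [hP Cw ->]]]; exists (fun v => ~ P v), w; split=> //; exact: gd_not.
Qed.

(** The two lists of parameters are interleaved, [v] at the even positions and [w] at the odd
    ones. *)
Lemma cdefI (C A B : set G) : cdef iota C A -> cdef iota C B -> cdef iota C (A `&` B).
Proof.
move=> [P [v [hP Cv ->]]] [Q [w [hQ Cw ->]]].
pose r1 i := if i is j.+1 then j.*2.+1 else 0.
pose r2 i := if i is j.+1 then j.*2.+2 else 0.
exists (fun u => P (fun i => u (r1 i)) /\ Q (fun i => u (r2 i))),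
  (fun i => if odd i then w i./2 else v i./2); split.
- by apply: gd_and; [exact: (gd_subst r1 hP) | exact: (gd_subst r2 hQ)].
- by move=> i; case: ifP.
- apply/predeqP => x; rewrite /mkset.
  set u := scons x _.
  have -> : (fun i => u (r1 i)) = scons x v.
    by apply/funext => -[|i] //=; rewrite odd_double doubleK.
  have -> // : (fun i => u (r2 i)) = scons x w.
  by apply/funext => -[|i] //=; rewrite odd_double /= uphalf_double.
Qed.

Lemma cdef_translate (C B : set G) c : C c -> cdef iota C B ->
  cdef iota C [set x | B (c * x)].
Proof.
move=> Cc [P [w [hP Cw ->]]].
exists (fun v => P (scons (v 1%N * v 0) (fun i => v i.+2))), (scons c w); split=> //.
  exact: (gd_scons _ (gterm_mul hG (gterm_var 1) (gterm_var 0)) hP).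
by case.
Qed.

Lemma coreM a b x y : core iota X a x -> core iota X b y -> core iota X (a + b) (x * y).
Proof. by move=> xa yb Y hY; apply: set_powD; [exact: xa | exact: yb]. Qed.

Lemma coreV a x : core iota X a x -> core iota X a x^-1.
Proof. by move=> xa Y hY; apply: set_powV (xa _ hY); case: hY. Qed.

Lemma core_le a b : a <= b -> core iota X a `<=` core iota X b.
Proof.
by move=> ab x xa Y hY; apply: set_pow_le ab _ (xa _ hY); case: hY => _ _ _ [].
Qed.

(** Otherwise pick [g m] in [S] outside [core m] for each [m]. These elements generate a countable
    subgroup, so saturation applies with its elements as parameters, and [compact_covering] puts it
    inside a single [core m], against the choice of [g m]. *)
Lemma type_definable_sub_core (S : set G) : subgroup S -> gtype_definable iota S ->
  S `<=` generated (core iota X 2) -> exists m, S `<=` core iota X m.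
Proof.
move=> S_subgroup /(gtype_definableP hG)[T [hT ST]] SX.
have [S1 SM SV] := S_subgroup.
have cover x : S x -> exists m, core iota X m x.
  move=> /SX; apply: (@generated_min _ _ [set x | exists m, core iota X m x]); last first.
    by move=> y; exists 2.
  split; first by exists 0.
    by move=> y z [a ya] [b zb]; exists (a + b)%N; exact: coreM.
  by move=> y [a ya]; exists a; exact: coreV.
apply: contrapT => nS.
have /choice[g Hg] : forall m, exists g, S g /\ ~ core iota X m g.
  move=> m; apply: contrapT => H; apply: nS; exists m => g Sg.
  by apply: contrapT => ng; apply: H; exists g.
(* The letter [(m, true)] stands for [g m] and [(m, false)] for its inverse; there are countably
   many words. *)
pose word (s : seq (nat * bool)) :=
  foldr (fun p x => (if p.2 then g p.1 else (g p.1)^-1) * x) 1 s.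
have word_cat s t : word (s ++ t) = word s * word t.
  by elim: s => [|p s IH] /=; rewrite ?mul1g // IH mulgA.
have Gam_subgroup : subgroup (range word).
  split; first by exists [::].
    by move=> _ _ [s _ <-] [t _ <-]; exists (s ++ t).
  move=> _ [s _ <-]; elim: s => [|[m b] s [t _ Et]] /=; first by exists [::]; rewrite ?invg1.
  exists (rcons t (m, ~~ b)) => //; rewrite -cats1 word_cat Et invgM /= mulg1.
  by case: b => //=; rewrite invgK.
have GamS : range word `<=` S.
  move=> _ [s _ <-]; elim: s => [//|[m b] s IH] /=; apply: SM => //.
  by case: b => /=; [|apply: SV]; exact: (Hg m).1.
have G1 : range word 1 by exists [::].
have [||||||||||m GamP] := @compact_covering G S (range word) (cdef iota (range word))
  (core iota X) S_subgroup Gam_subgroup GamS.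
- by apply: cdef_gset G1 _; exact: gd_true.
- by move=> B; exact: cdefC.
- by move=> A B; exact: cdefI.
- by move=> c B Gc; exact: cdef_translate.
- move=> F FB Fm.
  (* The family [T] defines [S], so a point realising [F] together with [T] realises [F] inside
     [S]. *)
  have [|||x xP] := saturation hM hG (C := range word) (F := F `|` T).
  + apply: (countable_bounded hM); apply: coords_countable.
    by apply: card_le_trans (card_image_le _ _) _; exact: countableP.
  + by move=> B [/FB//|/hT]; exact: (cdef_gset G1).
  + move=> s sF; have [|x Sx xs] := Fm [seq B <- s | `[< F B >]].
      by move=> B; rewrite mem_filter => /andP[/asboolP].
    exists x => B Bs; have [FBB|TB] := sF _ Bs.
      by apply: xs; rewrite mem_filter Bs andbT; apply/asboolP.
    by move: Sx; rewrite ST; exact.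
  + exists x => [|B FBB]; first by rewrite ST => B TB; apply: xP; right.
    by apply: xP; left.
- exact: coreM.
- exact: coreV.
- exact: core_le.
- move=> m x nx.
  have [Y hY nY] : exists2 Y, generic_symmetric iota X Y & ~ set_pow Y m x.
    apply: contrapT => H; apply: nx => Y hY; apply: contrapT => nY.
    by apply: H; exists Y.
  exists (set_pow Y m); split=> //; last by move=> y /(_ _ hY).
  apply: cdef_gset G1 _; apply: gset_pow => //.
  by apply/(gset_gdefinable hG); case: hY.
- exact: cover.
- apply: (Hg m).2; apply: GamP; exists [:: (m, true)] => //=.
  by rewrite mulg1.
Qed.

End Newelski.

Theorem proposition5p6 (L : language) (M : structure L) (K : Type)
    (hM : monster K M)
    (G : groupType) (n : nat) (iota : G -> n.-tuple M)
    (hG : definable_group iota)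
    (X : set G) (hXdef : gdefinable iota X) (hX : approximate_subgroup X) :
  [<->
    (* (1) *)
    exists H000 H00 : set G,
      [/\ is_H000 iota K (generated X) H000,
          is_H00 iota K (generated X) H00 & H000 = H00];
    (* (2) *)
    exists H00 : set G, is_H00 iota K (generated X) H00 /\
      exists2 m : nat, 1 <= m &
        forall Y : set G, generic_symmetric iota X Y -> H00 `<=` set_pow Y m;
    (* (3) *)
    exists H000 : set G, is_H000 iota K (generated X) H000 /\
      exists2 m : nat, 1 <= m &
        forall Y : set G, generic_symmetric iota X Y -> H000 `<=` set_pow Y m].
Proof.
have Q000 := generated_core2_H000 hM hG hXdef hX.
have inv S := @gtype_definable_invariant _ _ _ _ _ hG S.
tfae.
- move=> [H000 [S [[_ H000min] HS E]]]; rewrite {H000}E in H000min.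
  exists S; split=> //; have [[S_subgroup _ S_def _] _] := HS.
  have [m Sm] := type_definable_sub_core hM hG S_subgroup S_def (H000min _ Q000.1).
  (* The shift makes the exponent at least 1. *)
  exists m.+1 => // Y hY x /Sm/(core_le (leqnSn m)); exact.
- move=> [S [[[S_subgroup SX S_def S_bdd] Smin] [m m1 SY]]].
  exists (generated (core iota X 2)); split=> //; exists m => // Y hY.
  (* Type-definable sets are invariant, so the minimality of H^000 applies to H^00. *)
  apply: subset_trans (SY _ hY); apply: Q000.2; split=> //; exact: inv.
- move=> [S [[[S_subgroup SX S_inv S_bdd] Smin] [m m1 SY]]].
  have E : S = core iota X m.
    apply/seteqP; split=> [x Sx Y hY|]; first exact: SY.
    exact: (core_sub hM hG hXdef hX).
  exists S, S; split=> //.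
  split; first by split=> //; rewrite E; exact: core_gtype_definable.
  by move=> S' [? ? /inv ? ?]; exact: Smin.
Qed.
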